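(* Let $m\ge 3$ be odd and $q=2^m$. On the set of codewords of the quaternary Delsarte-Goethals code $\mathcal{DG}$ of length $q$, define the following ten relations, where $w_L$ denotes Lee weight and $\mathcal{K}\subseteq\mathcal{DG}$ is the quaternary Kerdock code: $(x,y)\in S_0$ if $w_L(x-y)=0$; $(x,y)\in S_1$ if $w_L(x-y)=q-\sqrt{2q}$; $(x,y)\in S'_{21}$ if $w_L(x-y)=q-\sqrt{q/2}$ and $x-y\in\mathcal{K}$; $(x,y)\in S'_{22}$ if $w_L(x-y)=q-\sqrt{q/2}$ and $x-y\notin\mathcal{K}$; $(x,y)\in S_3$ if $w_L(x-y)=q$ and $x-y\in\mathcal{K}$; $(x,y)\in S_4$ if $w_L(x-y)=q$ and $x-y\notin\mathcal{K}$; $(x,y)\in S'_{51}$ if $w_L(x-y)=q+\sqrt{q/2}$ and $x-y\notin\mathcal{K}$; $(x,y)\in S'_{52}$ if $w_L(x-y)=q+\sqrt{q/2}$ and $x-y\in\mathcal{K}$; $(x,y)\in S_6$ if $w_L(x-y)=q+\sqrt{2q}$; $(x,y)\in S_7$ if $w_L(x-y)=2q$. Then these relations define a $9$-class abelian (translation) association scheme $\mathfrak{B}$ on $\mathcal{DG}$.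
   Context: Let $R=GR(4,m)$ be the Galois ring of characteristic $4$ with $4^m$ elements, $\beta$ a unit of order $2^m-1$, $\mathcal{T}=\{0,1,\beta,\ldots,\beta^{2^m-2}\}$ the Teichmüller set, and $\mathrm{T}:R\to\mathbb{Z}_4$ the trace. For $u\in\mathbb{Z}_4,a\in R,b\in\mathcal{T}$ let $\mathbf{c}(u,a,b)\in\mathbb{Z}_4^q$ be indexed by $x\in\mathcal{T}$ with entries $u+\mathrm{T}(ax+2bx^3)$. Then $\mathcal{DG}=\{\mathbf{c}(u,a,b)\}$ and the Kerdock code is $\mathcal{K}=\{\mathbf{c}(u,a,0)\}$. The nonzero Lee weights of $\mathcal{DG}$ are $q\pm\sqrt{2q}$, $q\pm\sqrt{q/2}$, $q$, $2q$. *)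

(* Defs.v *)
From HB Require Import structures.
From mathcomp Require Import all_boot all_order all_algebra.
Set Implicit Arguments.
Unset Strict Implicit.
Unset Printing Implicit Defensive.
Import Order.TTheory GRing.Theory Num.Theory.
Local Open Scope ring_scope.

HB.instance Definition _ (aT : finType) (rT : finZmodType) :=
  GRing.Zmodule.on {ffun aT -> rT}.

Section GaloisRing.
Variable R : finComUnitRingType.

(* R is (isomorphic to) the Galois ring GR(4,m): a finite commutative local
   ring of characteristic 4, with 4^m elements, whose maximal ideal is 2R
   (the non-units are exactly the multiples of 2).  These properties
   characterise GR(4,m) up to isomorphism. *)
Definition galois_ring4 (m : nat) : Prop :=
  [/\ #|R| = (4 ^ m)%N,
      4%:R = 0 :> R,
      2%:R != 0 :> R &
      forall x : R, x \isn't a GRing.unit -> exists y : R, x = 2%:R * y].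

Definition unit_of_order (m : nat) (beta : R) : Prop :=
  [/\ beta \is a GRing.unit,
      beta ^+ (2 ^ m).-1 = 1 &
      forall k : nat, (0 < k < (2 ^ m).-1)%N -> beta ^+ k != 1].

Definition teich (m : nat) (beta : R) : {set R} :=
  0 |: [set beta ^+ (val i) | i : 'I_(2 ^ m).-1].

Definition twoR : {set R} := [set 2%:R * y | y : R].

Definition teich_a (m : nat) (beta : R) (x : R) : R :=
  odflt 0 [pick a in teich m beta | (x - a) \in twoR].
Definition teich_b (m : nat) (beta : R) (x : R) : R :=
  odflt 0 [pick b in teich m beta | x == teich_a m beta x + 2%:R * b].

Definition frob (m : nat) (beta : R) (x : R) : R :=
  teich_a m beta x ^+ 2 + 2%:R * teich_b m beta x ^+ 2.

(* trace T(x) = sum_{j<m} sigma^j(x), an element of the prime subring Z_4 *)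
Definition gtrace (m : nat) (beta : R) (x : R) : R :=
  \sum_(j < m) iter j (frob m beta) x.

Definition toZ4 (r : R) : 'Z_4 :=
  odflt 0 [pick k : 'Z_4 | (val k)%:R == r].

Definition coord (m : nat) (beta : R) := {x : R | x \in teich m beta}.

Local Notation word m beta := {ffun coord m beta -> 'Z_4}.

Definition cw (m : nat) (beta : R) (u : 'Z_4) (a b : R) : word m beta :=
  [ffun x => u + toZ4 (gtrace m beta (a * val x + 2%:R * b * val x ^+ 3))].

Definition DG (m : nat) (beta : R) : {set word m beta} :=
  [set v | [exists u : 'Z_4, exists a : R,
              exists b in teich m beta, v == cw m beta u a b]].

Definition Kerdock (m : nat) (beta : R) : {set word m beta} :=
  [set v | [exists u : 'Z_4, exists a : R, v == cw m beta u a 0]].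

End GaloisRing.

Notation word R m beta := {ffun @coord R m beta -> 'Z_4}.

Definition leeZ4 (k : 'Z_4) : nat := minn (val k) (4 - val k).
Definition lee (I : finType) (v : {ffun I -> 'Z_4}) : nat :=
  \sum_(i : I) leeZ4 (v i).

Definition assoc_scheme (V : finType) (S : {set V}) (d : nat)
    (rl : 'I_d.+1 -> rel V) : Prop :=
  [/\
      (forall x y, x \in S -> y \in S -> exists! i, rl i x y),
      (forall x y, x \in S -> y \in S -> rl ord0 x y = (x == y)),
      (forall i, exists x, exists y, [/\ x \in S, y \in S & rl i x y]),
      (forall i, exists j, forall x y, x \in S -> y \in S -> rl i x y = rl j y x)
    &
      (forall i j k, exists p : nat, forall x y, x \in S -> y \in S ->
         rl k x y -> #|[set z in S | rl i x z && rl j z y]| = p)].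

Definition commutative_scheme (V : finType) (S : {set V}) (d : nat)
    (rl : 'I_d.+1 -> rel V) : Prop :=
  forall i j x y, x \in S -> y \in S ->
    #|[set z in S | rl i x z && rl j z y]| = #|[set z in S | rl j x z && rl i z y]|.

Definition translation_scheme (V : finZmodType) (S : {set V}) (d : nat)
    (rl : 'I_d.+1 -> rel V) : Prop :=
  [/\ 0 \in S, (forall x y, x \in S -> y \in S -> x - y \in S)
    & forall i x y z, x \in S -> y \in S -> z \in S ->
        rl i x y = rl i (x + z) (y + z)].

(* The ten relations S_0, S_1, S'_21, S'_22, S_3, S_4, S'_51, S'_52, S_6, S_7
   (indices 0..9).  For m odd, sqrt(2q) = 2^((m+1)/2), sqrt(q/2) = 2^((m-1)/2). *)
Definition dg_rel (R : finComUnitRingType) (m : nat) (beta : R)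
    (i : 'I_10) : rel (word R m beta) :=
  fun x y =>
    let q := (2 ^ m)%N in
    let s1 := (2 ^ (m.+1)./2)%N in
    let s2 := (2 ^ (m.-1)./2)%N in
    let w := lee (x - y) in
    let k := (x - y) \in Kerdock m beta in
    match val i with
    | 0 => w == 0%N
    | 1 => w == (q - s1)%N
    | 2 => (w == (q - s2)%N) && k
    | 3 => (w == (q - s2)%N) && ~~ k
    | 4 => (w == q) && k
    | 5 => (w == q) && ~~ k
    | 6 => (w == q + s2)%N && ~~ k
    | 7 => (w == q + s2)%N && k
    | 8 => w == (q + s1)%N
    | _ => w == (2 * q)%N
    end.

(* Main.v *)
Require Import Defs.
From HB Require Import structures.
From mathcomp Require Import all_boot all_order all_algebra.
From mathcomp Require Import finalg algC ring zify.

(* The codewords form a group isomorphic to G = Z_4 x R x F (F the residue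
   field), which is self-dual for <(u,a,b),(s,A,B)> = us + tr(aA) + lam(bB),
   and the entry at x of the word of g is <g, e_x> with e_x = (1, x, x^3).
   Its Lee weight is q - Re S(g), where S(g) = sum_x i^<g,e_x>; the norm |S|^2
   is controlled by a kernel of 1 + r elements, r being the number of roots of
   the cubic b^2 z^3 + a^4 z + b.  By Bridges and Mena, the partition of G by
   the relations gives a scheme as soon as the characters of G carry a partition
   with equally many cells for which the Fourier transform exchanges the two
   spaces of class functions.  These ten-dimensional spaces are spanned by 1,
   1_K, 1_(a in 2R, b = 0), the indicators of the all-0 and the all-2 word, the
   indicator rho of b <> 0 and r = 0 (equivalently |Re S|^2 = q/2 off K), and
   the products of 1, 1_K, rho and Re S by Re S: all these transforms are
   explicit.  The delicate one is that of rho, which takes two values on the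
   characters (0, 2A, B) with A <> 0; this comes from
   3 rho = 2 - r - (-1)^Tr(a^3/b) and from counting the roots of
   v^3 + A v^2 + B. *)

Set Implicit Arguments.
Unset Strict Implicit.
Unset Printing Implicit Defensive.
Import Order.TTheory GRing.Theory Num.Theory.
Local Open Scope ring_scope.

(** * The Galois ring and its residue field *)

(** The functions at hand dictate the dual cells. A function of (pi a, b) alone has its transform
    supported on H, the characters (0, 2A, B), on which the available transforms distinguish four
    cells. Since 2 Re S is the sum of the characters at e_x and -e_x, multiplying by it translates
    transforms by these points; an odd character has exactly one such translate in H, so the four
    cells are copied onto the odd characters. The square of 2 Re S counts representations by two
    signed points, and this count takes only two values on the remaining even characters: two more
    cells. Oddness of m enters twice: [zeta 1 = -1], so F has no primitive cube root of unity, and q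
    is an odd power of 2, so that |S|^2, a sum of two squares, controls |Re S|. That the ten
    relations are nonempty is not proved by counting weights: it follows from the duality itself. *)

(* [F] is the residue field of [R = GR(4,m)], [pi] the reduction modulo 2,
   [tau] the Teichmuller lift and [tr] the trace. *)
Record teichmuller (R : finComUnitRingType) (F : finFieldType) (m : nat)
    (pi : {rmorphism R -> F}) (tau : F -> R) (tr : R -> 'Z_4) : Prop := {
  tm_card : #|F| = (2 ^ m)%N;
  tm_tauK : cancel tau pi;
  tm_tauM : {morph tau : x y / x * y};
  tm_tau0 : tau 0 = 0;
  tm_tau_sqrD : forall x y, tau ((x + y) ^+ 2) = (tau x + tau y) ^+ 2;
  tm_pi_eq0 : forall r, pi r = 0 -> exists x, r = 2%:R * tau x;
  tm_two_tau : forall r, 2%:R * tau (pi r) = 2%:R * r;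
  tm_char4 : 4%:R = 0 :> R;
  tm_two_tau_eq0 : forall x, 2%:R * tau x = 0 -> x = 0;
  tm_trD : {morph tr : x y / x + y};
  tm_tr_sqr : forall r, tr (2%:R * r ^+ 2) = tr (2%:R * r);
  tm_tr2 : tr 2%:R = inZp 2;
  tm_tr_nondeg : forall a, (forall x, tr (a * x) = 0) -> a = 0 }.

Section GaloisRingTheory.
Variables (m : nat) (R : finComUnitRingType) (beta : R).
Hypotheses (m_gt0 : (0 < m)%N) (HR : galois_ring4 R m).
Hypothesis Hbeta : unit_of_order m beta.
Local Notation q := (2 ^ m)%N.
Local Notation T := (teich m beta).

Lemma gr_char4 : 4%:R = 0 :> R. Proof. by case: HR. Qed.

Lemma gr_char22 : 2%:R * 2%:R = 0 :> R. Proof. by rewrite -natrM gr_char4. Qed.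

Lemma gr_two_neq0 : 2%:R != 0 :> R. Proof. by case: HR. Qed.

Lemma gr_nonunit (x : R) : x \isn't a GRing.unit -> exists y, x = 2%:R * y.
Proof. by case: HR => _ _ _; apply. Qed.

Lemma gr_unitE (x : R) : (x \is a GRing.unit) = (2%:R * x != 0).
Proof.
apply/idP/idP => [Ux|]; last first.
  by apply: contraR => /gr_nonunit[y ->]; rewrite mulrA gr_char22 mul0r.
apply: contra gr_two_neq0 => /eqP x0; apply/eqP.
by rewrite -[LHS](mulrK Ux) x0 mul0r.
Qed.

(** Nonunits are exactly the elements killed by 2, so congruence modulo 2R can be written as an
    equality of doubles; this form is used throughout. *)
Lemma gr_eq2 (x y : R) : 2%:R * x = 2%:R * y -> exists z, x = y + 2%:R * z.
Proof.
move=> xy; have /gr_nonunit[z zE] : x - y \isn't a GRing.unit.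
  by rewrite gr_unitE mulrBr xy subrr eqxx.
by exists z; rewrite -zE addrC subrK.
Qed.

Lemma gr_sqr_mod2 (x y : R) : 2%:R * x = 2%:R * y -> x ^+ 2 = y ^+ 2.
Proof.
move=> /gr_eq2[z ->]; have c4 := gr_char4.
have -> : (y + 2%:R * z) ^+ 2 = y ^+ 2 + 4%:R * (y * z + z ^+ 2) by ring.
by rewrite c4 mul0r addr0.
Qed.

(** Squaring turns a congruence modulo 2 into an equality, the error carrying a factor 4. Hence
    [x ^+ q] depends only on the residue of [x]: it is the Teichmuller representative. *)
Lemma gr_expq_mod2 (x y : R) : 2%:R * x = 2%:R * y -> x ^+ q = y ^+ q.
Proof.
by move=> /gr_sqr_mod2 xy; rewrite -(prednK m_gt0) expnS !exprM xy.
Qed.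

Lemma teichP (x : R) : reflect (x = 0 \/ exists i, x = beta ^+ i) (x \in T).
Proof.
case: Hbeta => _ b1 _; have q1 : (0 < q.-1)%N.
  by rewrite -ltnS prednK ?expn_gt0 // -(expn0 2) ltn_exp2l.
apply: (iffP idP).
  case/setU1P => [->|/imsetP[i _ ->]]; first by left.
  by right; exists (val i).
case=> [->|[i ->]]; first exact: setU11.
apply/setU1P; right; apply/imsetP.
exists (Ordinal (ltn_pmod i q1)) => //=.
by rewrite {1}(divn_eq i q.-1) exprD mulnC exprM b1 expr1n mul1r.
Qed.

Lemma teich_expq (x : R) : x \in T -> x ^+ q = x.
Proof.
case: Hbeta => _ b1 _; have q0 : (0 < q)%N by rewrite expn_gt0.
case/teichP => [->|[i ->]]; first by rewrite expr0n; case: (q) q0.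
by rewrite -exprM mulnC exprM -(prednK q0) exprSr b1 mul1r.
Qed.

Lemma teich_inj2 : {in T &, injective (fun x : R => 2%:R * x)}.
Proof.
by move=> x y Tx Ty /gr_expq_mod2; rewrite !teich_expq.
Qed.

Lemma card_teich : #|T| = q.
Proof.
case: Hbeta => Ub b1 bk; have q0 : (0 < q)%N by rewrite expn_gt0.
rewrite cardsU1 card_imset ?card_ord; last first.
  move=> i j /= /eqP; wlog lij : i j / (val i < val j)%N => [hw|].
    case: (ltngtP (val i) (val j)) => [|lji /eqP eij|/val_inj->//]; first exact: hw.
    by apply/esym/hw => //; rewrite eij.
  rewrite -(subnK (ltnW lij)) exprD -[X in X == _]mul1r => /eqP /(mulIr (unitrX _ Ub)).
  move=> /esym e; have /bk : (0 < val j - val i < q.-1)%N.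
    by rewrite subn_gt0 lij; apply: leq_ltn_trans (leq_subr _ _) (ltn_ord j).
  by rewrite e eqxx.
suff -> : (0 \in [set beta ^+ val i | i : 'I_q.-1]) = false by rewrite add1n prednK.
apply/negP => /imsetP[i _ /esym b0]; have := unitrX i Ub.
by rewrite b0 unitr0.
Qed.

(** Existence by counting: the q^2 pairs of digits give distinct elements, and R has 4^m = q^2
    elements. *)
Lemma teich_decomp (x : R) : exists a b, [/\ a \in T, b \in T & x = a + 2%:R * b].
Proof.
pose h (p : R * R) : R := p.1 + 2%:R * p.2.
have hinj : {in setX T T &, injective h}.
  move=> [a b] [c d] /setXP[Ta Tb] /setXP[Tc Td]; rewrite /h /= => e.
  have eac : a = c.
    apply: teich_inj2 => //; have := congr1 (fun z : R => 2%:R * z) e.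
    by rewrite !mulrDr !mulrA gr_char22 !mul0r !addr0.
  by move: e; rewrite eac => /addrI/teich_inj2 ->.
have cardh : #|h @: setX T T| = #|R|.
  rewrite card_in_imset // cardsX card_teich; case: HR => -> _ _ _.
  by rewrite -expnMn.
have : x \in h @: setX T T by rewrite (subset_cardP cardh (subset_predT _)).
by case/imsetP => -[a b] /setXP[Ta Tb] ->; exists a, b.
Qed.

Lemma mem_teich (x : R) : (x \in T) = (x ^+ q == x).
Proof.
apply/idP/eqP => [/teich_expq//|].
have [a [b [Ta _ ->]]] := teich_decomp x.
have -> : (a + 2%:R * b) ^+ q = a.
  rewrite -[RHS](teich_expq Ta); apply: gr_expq_mod2.
  by rewrite mulrDr mulrA gr_char22 mul0r addr0.
by move=> <-.
Qed.

Lemma gr_two_expq (x : R) : 2%:R * x ^+ q = 2%:R * x.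
Proof.
have [a [b [Ta _ ->]]] := teich_decomp x.
have eab : 2%:R * (a + 2%:R * b) = 2%:R * a.
  by rewrite mulrDr mulrA gr_char22 mul0r addr0.
by rewrite (gr_expq_mod2 eab) eab teich_expq.
Qed.

Lemma teich_pow (x : R) : x ^+ q \in T.
Proof. by rewrite mem_teich; apply/eqP/gr_expq_mod2/gr_two_expq. Qed.

Lemma teichM (x y : R) : x \in T -> y \in T -> x * y \in T.
Proof. by rewrite !mem_teich exprMn => /eqP-> /eqP->. Qed.

Lemma teichX (x : R) n : x \in T -> x ^+ n \in T.
Proof. by rewrite !mem_teich exprAC => /eqP->. Qed.

Lemma teich0 : 0 \in T. Proof. by apply/teichP; left. Qed.

Lemma teich_sqrt (x : R) : x \in T -> exists2 y, y \in T & x = y ^+ 2.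
Proof.
move=> Tx; exists (x ^+ (2 ^ m.-1)); first exact: teichX.
by rewrite -exprM -expnSr prednK // teich_expq.
Qed.

(** A square depends only on the residue. Read as x^2 + y^2 = (x + y)^2 - 2xy, this is the rule for
    adding Teichmuller elements. *)
Lemma teich_sqrD (x y : R) : x \in T -> y \in T -> (x + y) ^+ 2 \in T.
Proof.
move=> Tx Ty; rewrite mem_teich exprAC; apply/eqP/gr_sqr_mod2.
exact: gr_two_expq.
Qed.

Lemma teich_uniq (a b c d : R) : a \in T -> b \in T -> c \in T -> d \in T ->
  a + 2%:R * b = c + 2%:R * d -> a = c /\ b = d.
Proof.
move=> Ta Tb Tc Td e.
have eac : a = c.
  apply: teich_inj2 => //; have := congr1 (fun z : R => 2%:R * z) e.
  by rewrite !mulrDr !mulrA gr_char22 !mul0r !addr0.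
by move: e; rewrite eac => /addrI/teich_inj2 ->.
Qed.

Lemma teich_aE (a b : R) : a \in T -> b \in T -> teich_a m beta (a + 2%:R * b) = a.
Proof.
move=> Ta Tb; rewrite /teich_a; case: pickP => [c /=|/(_ a)/=]; last first.
  rewrite Ta addrC addKr; have -> // : 2%:R * b \in twoR R.
  by apply/imsetP; exists b.
case/andP=> Tc /imsetP[y _ e]; apply: teich_inj2 => //.
move/(canRL (subrK _)): e => /(congr1 (fun z : R => 2%:R * z)).
by rewrite !mulrDr !mulrA gr_char22 !mul0r add0r addr0.
Qed.

Lemma teich_bE (a b : R) : a \in T -> b \in T -> teich_b m beta (a + 2%:R * b) = b.
Proof.
move=> Ta Tb; rewrite /teich_b; case: pickP => [c /=|/(_ b)/=]; last first.
  by rewrite Tb teich_aE // eqxx.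
by rewrite teich_aE // => /andP[Tc /eqP /teich_uniq[]].
Qed.

Lemma frobE (a b : R) : a \in T -> b \in T ->
  frob m beta (a + 2%:R * b) = a ^+ 2 + 2%:R * b ^+ 2.
Proof. by move=> Ta Tb; rewrite /frob teich_aE ?teich_bE. Qed.

Lemma frobD (x y : R) : frob m beta (x + y) = frob m beta x + frob m beta y.
Proof.
have [a [b [Ta Tb ->]]] := teich_decomp x.
have [c [d [Tc Td ->]]] := teich_decomp y.
have [a' Ta' Ea] := teich_sqrt Ta; have [c' Tc' Ec] := teich_sqrt Tc.
have c4 := gr_char4.
(* As a + c = (a' + c')^2 - 2 a'c', the second digit of the sum is the residue of [w], represented
   in T by [w ^+ q]. *)
pose w := b + d - a' * c'.
have -> : a + 2%:R * b + (c + 2%:R * d) = (a' + c') ^+ 2 + 2%:R * w ^+ q.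
  by rewrite gr_two_expq Ea Ec /w; ring.
rewrite !frobE ?teich_pow ?teich_sqrD //.
have -> : 2%:R * (w ^+ q) ^+ 2 = 2%:R * w ^+ 2.
  by rewrite exprAC gr_two_expq.
rewrite Ea Ec /w.
have -> : ((a' + c') ^+ 2) ^+ 2 + 2 * (b + d - a' * c') ^+ 2 =
  (a' ^+ 2) ^+ 2 + 2 * b ^+ 2 + ((c' ^+ 2) ^+ 2 + 2 * d ^+ 2)
  + 4%:R * (a' ^+ 3 * c' + 2 * a' ^+ 2 * c' ^+ 2 + a' * c' ^+ 3
            + b * d - b * a' * c' - d * a' * c').
  ring.
by rewrite c4 mul0r addr0.
Qed.

Lemma iter_frob j (a b : R) : a \in T -> b \in T ->
  iter j (frob m beta) (a + 2%:R * b) = a ^+ (2 ^ j) + 2%:R * b ^+ (2 ^ j).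
Proof.
move=> Ta Tb; elim: j => [|j IHj]; first by rewrite !expr1.
by rewrite iterS IHj frobE ?teichX // -!exprM -!expnSr.
Qed.

Lemma iter_frobD j (x y : R) :
  iter j (frob m beta) (x + y) = iter j (frob m beta) x + iter j (frob m beta) y.
Proof. by elim: j => //= j ->; exact: frobD. Qed.

Lemma gtraceD (x y : R) :
  gtrace m beta (x + y) = gtrace m beta x + gtrace m beta y.
Proof.
by rewrite -big_split /=; apply: eq_bigr => j _; exact: iter_frobD.
Qed.

Lemma frob_iter_m (x : R) : iter m (frob m beta) x = x.
Proof.
have [a [b [Ta Tb ->]]] := teich_decomp x.
by rewrite iter_frob // !teich_expq.
Qed.

Lemma frob0 : frob m beta 0 = 0.
Proof. by apply: (addrI (frob m beta 0)); rewrite -frobD !addr0. Qed.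

Lemma frob_gtrace (x : R) : frob m beta (gtrace m beta x) = gtrace m beta x.
Proof.
rewrite /gtrace (big_morph _ frobD frob0).
case: m m_gt0 (frob_iter_m x) => // n _ e.
by rewrite big_ord_recr big_ord_recl /= -iterS e addrC.
Qed.

(** * The trace as a map to Z_4 *)

Definition z4r (k : 'Z_4) : R := (val k)%:R.

Lemma z4rD (k l : 'Z_4) : z4r (k + l) = z4r k + z4r l.
Proof.
have c4 := gr_char4; rewrite /z4r -natrD /= /Zp_trunc /=.
rewrite [in RHS](divn_eq (val k + val l) 4) natrD natrM.
by rewrite [4%:R]c4 mulr0 add0r.
Qed.

Lemma z4r_inj : injective z4r.
Proof.
have c2 := gr_two_neq0.
have kerz (k : 'Z_4) : z4r k = 0 -> k = 0.
  case: k => [[|[|[|[|]]]] ?] //; rewrite /z4r /= => e; first exact: val_inj.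
  - by case/eqP: (oner_neq0 R).
  - by rewrite e eqxx in c2.
  - by case/eqP: (oner_neq0 R); rewrite -gr_char4 (natrD _ 3 1) e add0r.
move=> k l e; apply/eqP; rewrite -subr_eq0; apply/eqP/kerz.
by apply: (addIr (z4r l)); rewrite -z4rD subrK add0r.
Qed.

Lemma toZ4K : cancel z4r (@toZ4 R).
Proof.
move=> k; rewrite /toZ4; case: pickP => [l /eqP/z4r_inj//|/(_ k)].
by rewrite eqxx.
Qed.

(** The digits of a fixed element satisfy a^2 = a and b^2 = b, hence are 0 or 1, which leaves the
    four elements of the prime ring. *)
Lemma frob_fixed (x : R) : frob m beta x = x -> exists k, x = z4r k.
Proof.
have [a [b [Ta Tb ->]]] := teich_decomp x.
rewrite frobE // => /teich_uniq[] //; try exact: teichX.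
have idem (c : R) : c \in T -> c ^+ 2 = c -> c = 0 \/ c = 1.
  move=> Tc cc; have [Uc|/gr_nonunit[y cE]] := boolP (c \is a GRing.unit).
    by right; apply: (mulrI Uc); rewrite mulr1 -expr2.
  left; rewrite -cc cE exprMn expr2 gr_char22 mul0r //.
move=> /(idem _ Ta)[]-> /(idem _ Tb)[]->.
- by exists (inZp 0); rewrite mulr0 addr0.
- by exists (inZp 2); rewrite mulr1 add0r.
- by exists (inZp 1); rewrite mulr0 addr0.
- by exists (inZp 3); rewrite mulr1 /z4r /= -(natrD _ 1 2).
Qed.

Definition z4trace (x : R) : 'Z_4 := toZ4 (gtrace m beta x).

Lemma z4traceK (x : R) : z4r (z4trace x) = gtrace m beta x.
Proof.
by have [k kE] := frob_fixed (frob_gtrace x); rewrite /z4trace kE toZ4K.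
Qed.

Lemma z4traceD (x y : R) : z4trace (x + y) = z4trace x + z4trace y.
Proof. by apply: z4r_inj; rewrite z4rD !z4traceK gtraceD. Qed.

Lemma gtrace_two (x : R) :
  gtrace m beta (2%:R * x) = 2%:R * \sum_(j < m) x ^+ (2 ^ j).
Proof.
rewrite -(gr_two_expq x) -[2%:R * _]add0r big_distrr; apply: eq_bigr => j _ /=.
rewrite iter_frob ?teich0 ?teich_pow // expr0n; case: eqP => [/eqP|_].
  by rewrite expn_eq0.
by rewrite add0r exprAC gr_two_expq.
Qed.

Lemma z4trace_two_sqr (x : R) : z4trace (2%:R * x ^+ 2) = z4trace (2%:R * x).
Proof.
apply: z4r_inj; rewrite !z4traceK !gtrace_two.
have Eq := gr_two_expq x; case: m m_gt0 Eq => // n _ Eq.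
rewrite big_ord_recr big_ord_recl /= !mulrDr -exprM -expnS Eq expr1 addrC.
by congr (_ + _); congr (_ * _); apply: eq_bigr => j _; rewrite -exprM -expnS.
Qed.

(** The trace of 2 is 2m. For odd m this is nonzero, and becomes [zeta 1 = -1], on which all the
    facts about cubics rest. *)
Lemma z4trace_two : odd m -> z4trace 2%:R = inZp 2.
Proof.
move=> om; apply: z4r_inj; rewrite z4traceK -[2%:R]mulr1 gtrace_two.
rewrite (eq_bigr (fun=> 1)) => [|j _]; last by rewrite expr1n.
rewrite sumr_const card_ord -(odd_double_half m) om mulrnDr -muln2 natrM.
by rewrite mulrDr [_%:R * 2%:R]mulrC mulrA gr_char22 mul0r addr0 mulr1.
Qed.

(** * The residue field carried by the Teichmuller set *)

(** The field structure is put on the index set of the codewords itself: operations of R followed by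
    the q-th power. The lift is then the inclusion, and a sum over coordinates is a sum over F. *)
Definition resF := Defs.coord m beta.

Definition res_mk (x : R) : resF := Sub (x ^+ q) (teich_pow x).

Lemma two_res_mk (x : R) : 2%:R * val (res_mk x) = 2%:R * x.
Proof. exact: gr_two_expq. Qed.

Lemma res_eq (u v : resF) : 2%:R * val u = 2%:R * val v -> u = v.
Proof. by move=> e; apply/val_inj/teich_inj2 => //; apply: valP. Qed.

HB.instance Definition _ := Finite.copy resF (Defs.coord m beta).

Definition res_add (u v : resF) : resF := res_mk (val u + val v).
Definition res_opp (u : resF) : resF := res_mk (- val u).
Definition res_mul (u v : resF) : resF := res_mk (val u * val v).
Definition res_inv (u : resF) : resF := res_mk (val u)^-1.

Lemma res_addA : associative res_add.
Proof. by move=> u v w; apply: res_eq; rewrite !(mulrDr, two_res_mk) addrA. Qed.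
Lemma res_addC : commutative res_add.
Proof. by move=> u v; apply: res_eq; rewrite !two_res_mk addrC. Qed.
Lemma res_add0 : left_id (res_mk 0) res_add.
Proof. by move=> u; apply: res_eq; rewrite !(mulrDr, two_res_mk) mulr0 add0r. Qed.
Lemma res_addN : left_inverse (res_mk 0) res_opp res_add.
Proof.
move=> u; apply: res_eq.
by rewrite !(mulrDr, two_res_mk) mulrN addNr mulr0.
Qed.
HB.instance Definition _ :=
  GRing.isZmodule.Build resF res_addA res_addC res_add0 res_addN.

Lemma two_res_mulr (x y : R) :
  2%:R * (x * val (res_mk y)) = 2%:R * (x * y).
Proof. by rewrite mulrCA two_res_mk mulrCA. Qed.
Lemma two_res_mull (x y : R) :
  2%:R * (val (res_mk x) * y) = 2%:R * (x * y).
Proof. by rewrite mulrA two_res_mk mulrA. Qed.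

Lemma res_mulA : associative res_mul.
Proof.
by move=> u v w; apply: res_eq; rewrite
  !(two_res_mk, two_res_mulr, two_res_mull) (mulrA (val u)).
Qed.
Lemma res_mulC : commutative res_mul.
Proof. by move=> u v; apply: res_eq; rewrite !two_res_mk (mulrC (val u)). Qed.
Lemma res_mul1 : left_id (res_mk 1) res_mul.
Proof. by move=> u; apply: res_eq; rewrite !(two_res_mk, two_res_mull) mul1r. Qed.
Lemma res_mulDl : left_distributive res_mul res_add.
Proof.
move=> u v w; apply: res_eq.
by rewrite !(two_res_mk, two_res_mull, mulrDr) (mulrDl (val u)) mulrDr.
Qed.
Lemma res_1neq0 : res_mk 1 != res_mk 0.
Proof.
apply/eqP => /(congr1 (fun u : resF => 2%:R * val u)).
by rewrite !two_res_mk mulr1 mulr0 => /eqP; rewrite (negPf gr_two_neq0).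
Qed.
HB.instance Definition _ := GRing.Zmodule_isComNzRing.Build resF
  res_mulA res_mulC res_mul1 res_mulDl res_1neq0.

Lemma res_mulV (u : resF) : u != 0 -> res_inv u * u = 1.
Proof.
move=> u0; apply: res_eq; rewrite !(two_res_mk, two_res_mull) mulVr ?mulr1 //.
rewrite gr_unitE; apply: contra u0 => /eqP e; apply/eqP/res_eq.
by rewrite e two_res_mk mulr0.
Qed.
Lemma res_inv0 : res_inv 0 = 0.
Proof.
apply: res_eq; rewrite !two_res_mk mulr0.
have -> : val (0 : resF) = 0 :> R.
  by rewrite /= expr0n expn_eq0.
by rewrite invr0 mulr0.
Qed.
HB.instance Definition _ := GRing.ComNzRing_isField.Build resF res_mulV res_inv0.

Fact res_mk_additive : zmod_morphism res_mk.
Proof.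
by move=> x y; apply: res_eq; rewrite !(two_res_mk, mulrDr, mulrN).
Qed.
Fact res_mk_multiplicative : monoid_morphism res_mk.
Proof.
split=> [|x y]; first by [].
by apply: res_eq; rewrite !(two_res_mk, two_res_mulr, two_res_mull).
Qed.
HB.instance Definition _ := GRing.isZmodMorphism.Build R resF res_mk res_mk_additive.
HB.instance Definition _ := GRing.isMonoidMorphism.Build R resF res_mk res_mk_multiplicative.

(** Every nonzero ideal of R contains 2, whose trace is not 0. *)
Lemma z4trace_nondeg (a : R) : odd m -> (forall x, z4trace (a * x) = 0) -> a = 0.
Proof.
move=> om a0; apply/eqP/contraT => an0.
have [y ay] : exists y, a * y = 2%:R.
  have [Ua|/gr_nonunit[z aE]] := boolP (a \is a GRing.unit).
    by exists (a^-1 * 2%:R); rewrite mulrA divrr ?mul1r.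
  exists z^-1; rewrite aE mulrK // gr_unitE.
  by apply: contra an0 => /eqP e; rewrite aE e.
by have := a0 y; rewrite ay z4trace_two.
Qed.

Lemma teichmuller_exists : odd m ->
  exists (F : finFieldType) (pi : {rmorphism R -> F}) (tau : F -> R)
         (h : F -> Defs.coord m beta),
    [/\ teichmuller m pi tau z4trace, bijective h & forall x, val (h x) = tau x].
Proof.
move=> om; pose F : finFieldType := resF.
exists F, (res_mk : {rmorphism R -> F}), (fun u : F => val (u : resF)), id.
split=> //; last by exists id.
split.
- by rewrite card_sig -card_teich; apply: eq_card => x; rewrite inE.
- by move=> u; apply: res_eq; rewrite two_res_mk.
- by move=> u v; rewrite /= -[RHS](teich_expq (teichM (valP u) (valP v))).
- by rewrite /= expr0n expn_eq0.
- move=> u v; rewrite -[RHS](teich_expq (teich_sqrD (valP u) (valP v))).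
  apply: teich_inj2; rewrite ?teich_pow //.
  rewrite gr_two_expq.
  transitivity (2%:R * val
    (res_mk (val (res_mk (val u + val v)) * val (res_mk (val u + val v))))) => //.
  by rewrite two_res_mk two_res_mulr two_res_mull.
- move=> r /(congr1 (fun u : resF => 2%:R * val u)).
  rewrite !two_res_mk mulr0 -[X in _ = X](mulr0 2%:R) => /gr_eq2[z ->].
  by exists (res_mk z); rewrite add0r two_res_mk.
- exact: two_res_mk.
- exact: gr_char4.
- move=> u u0; apply: res_eq.
  by rewrite [LHS]u0 two_res_mk mulr0.
- exact: z4traceD.
- exact: z4trace_two_sqr.
- exact: z4trace_two.
- by move=> a; apply: z4trace_nondeg.
Qed.

End GaloisRingTheory.

(** * Cubics over a binary field of odd degree *)

Section BinaryField.
Variables (F : finFieldType) (C : numFieldType) (zeta : F -> C).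
Hypothesis two0 : 2%:R = 0 :> F.
Hypothesis zetaD : {morph zeta : x y / x + y >-> x * y}.
Hypothesis zeta_sqr : forall x, zeta (x ^+ 2) = zeta x.
Hypothesis zeta1 : zeta 1 = -1.
Local Notation q := (#|F|%:R : C).

Lemma addxx (x : F) : x + x = 0.
Proof. by rewrite -mulr2n -mulr_natl two0 mul0r. Qed.

Lemma oppx (x : F) : - x = x.
Proof. by apply/eqP; rewrite eq_sym -addr_eq0 addxx. Qed.

Lemma addx_eq0 (x y : F) : (x + y == 0) = (x == y).
Proof. by rewrite -[y in RHS]oppx -addr_eq0. Qed.

Lemma zeta0 : zeta 0 = 1.
Proof.
have := zetaD 0 1; rewrite add0r zeta1 mulrN1 => /eqP.
by rewrite eqr_opp => /eqP.
Qed.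

Lemma zeta_pm (x : F) : zeta x = 1 \/ zeta x = -1.
Proof.
have /eqP := zetaD x x; rewrite addxx zeta0 -expr2 eq_sym sqrf_eq1.
by case/orP => /eqP ->; [left|right].
Qed.

Lemma zeta_neq (x : F) : zeta x <> 1 -> zeta x = -1.
Proof. by case: (zeta_pm x). Qed.

Lemma one_neqN1 : (1 : C) != -1.
Proof. by rewrite -subr_eq0 opprK (eqr_nat _ 2 0). Qed.

Lemma sqr_inj : injective (fun x : F => x ^+ 2).
Proof.
move=> x y /= /eqP; rewrite -subr_eq0 subr_sqr mulf_eq0 subr_eq0 addx_eq0 orbb.
by move/eqP.
Qed.

Definition fsqrt (x : F) : F := invF sqr_inj x.
Lemma fsqrtK (x : F) : fsqrt x ^+ 2 = x. Proof. exact: (f_invF sqr_inj x). Qed.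

Lemma zeta_X4 (x : F) : zeta (x ^+ 4) = zeta x.
Proof. by rewrite (exprM x 2 2) !zeta_sqr. Qed.

Lemma sum_zeta (a : F) : \sum_x zeta (x * a) = if a == 0 then q else 0.
Proof.
case: eqP => [->|/eqP a0].
  by rewrite (eq_bigr (fun=> 1)) ?sumr_const // => x _; rewrite mulr0 zeta0.
set s := LHS; have /eqP : s = - s.
  rewrite {1}/s (reindex_inj (addIr a^-1)) /= -sumrN; apply: eq_bigr => x _.
  by rewrite mulrDl mulVf // zetaD zeta1 mulrN1.
by rewrite -addr_eq0 -mulr2n mulrn_eq0 => /eqP.
Qed.

Lemma sum_zeta_neq0 (a : F) :
  \sum_(x | x != 0) zeta (x * a) = (if a == 0 then q else 0) - 1.
Proof.
rewrite -sum_zeta [in RHS](bigD1 0) //= mul0r zeta0 [1 + _]addrC addrK.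
by apply: eq_bigr.
Qed.

(** By orthogonality, q times the count is the double sum of zeta (a (t^2 + t + c)). Since zeta (a
    t^2) = zeta (sqrt a t), the sum over t vanishes unless a = sqrt a, that is, a = 0 or a = 1;
    these contribute 1 and zeta c. *)
Lemma card_artin_schreier (c : F) :
  #|[set t | t ^+ 2 + t == c]|%:R = 1 + zeta c.
Proof.
have q0 : q != 0 by rewrite pnatr_eq0 -lt0n; apply/card_gt0P; exists 0.
apply: (mulfI q0); rewrite -sum1dep_card natr_sum mulr_sumr.
transitivity (\sum_(t : F) \sum_a zeta (a * (t ^+ 2 + t + c))).
  rewrite [RHS](bigID (fun t => t ^+ 2 + t == c)) /= [X in _ + X]big1 ?addr0.
    by apply: eq_bigr => t /eqP->; rewrite sum_zeta addxx eqxx mulr1.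
  by move=> t tc; rewrite sum_zeta addx_eq0 (negPf tc).
rewrite exchange_big /=.
transitivity (\sum_(a : F) zeta (a * c) * (if (a == 0) || (a == 1) then q else 0)).
  apply: eq_bigr => a _.
  have -> : ((a == 0) || (a == 1)) = (a + fsqrt a == 0).
    move: (fsqrt a) (fsqrtK a) => s <-.
    have -> : s ^+ 2 + s = s * (s + 1) by ring.
    rewrite [in RHS]mulf_eq0 addx_eq0 expf_eq0 /=; congr (_ || _).
    by rewrite -(inj_eq sqr_inj s 1) /= expr1n.
  rewrite -sum_zeta mulr_sumr; apply: eq_bigr => t _.
  rewrite !mulrDr !zetaD mulrC; congr (_ * _).
  rewrite mulrC; congr (_ * _); first by rewrite mulrC.
  by rewrite -[RHS]zeta_sqr exprMn fsqrtK mulrC.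
rewrite (bigD1 0) //= (bigD1 1) ?oner_neq0 //= big1 => [|a /andP[a0 a1]]; last first.
  by rewrite (negPf a0) (negPf a1) mulr0.
by rewrite !eqxx orbT addr0 mul0r mul1r zeta0 -mulrDl mulrC.
Qed.

Lemma card_quadratic (a b : F) : a != 0 ->
  #|[set t | t ^+ 2 + a * t + b == 0]|%:R = 1 + zeta (b / a ^+ 2).
Proof.
move=> a0; rewrite -card_artin_schreier; congr (_%:R).
rewrite -[RHS](card_imset _ (mulfI a0)); apply: eq_card => t; rewrite !inE.
apply/idP/imsetP => [tr|[u]].
  exists (t / a); last by rewrite mulrCA divff ?mulr1.
  rewrite inE -addx_eq0; apply/eqP; apply: (mulfI (expf_neq0 2 a0)).
  by rewrite mulr0 -(eqP tr); field.
rewrite inE => /eqP uE ->; apply/eqP.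
have -> : b = a ^+ 2 * (b / a ^+ 2) by field.
rewrite -uE.
have -> : (a * u) ^+ 2 + a * (a * u) + a ^+ 2 * (u ^+ 2 + u) =
  2%:R * (a ^+ 2 * (u ^+ 2 + u)) by ring.
by rewrite two0 mul0r.
Qed.

(* A root [x0] splits the cubic as [(x + x0)(x^2 + x0 x + x0^2 + a)], so the
   Artin-Schreier criterion for the quadratic factor decides the root count. *)
Lemma card_cubic_root (a b x0 : F) : b != 0 -> x0 ^+ 3 + a * x0 + b = 0 ->
  #|[set x | x ^+ 3 + a * x + b == 0]|%:R = 2%:R - zeta (a ^+ 3 / b ^+ 2) /\
  zeta (a ^+ 3 / b ^+ 2) = zeta (a / x0 ^+ 2).
Proof.
move=> b0 /eqP; rewrite addx_eq0 eq_sym => /eqP bE.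
have x00 : x0 != 0 by apply: contra b0 => /eqP xE; rewrite bE xE expr0n mulr0 addr0.
have bE' : b = x0 * (x0 ^+ 2 + a) by rewrite bE; ring.
have xa0 : x0 ^+ 2 + a != 0 by apply: contra b0; rewrite bE' => /eqP->; rewrite mulr0.
have zE : zeta (a ^+ 3 / b ^+ 2) = zeta (a / x0 ^+ 2).
  (* This is b / x0^3. In terms of [v], a / x0^2 is v + 1 and a^3 / b^2 is v + 1 + (v^-1 + v^-2),
     where zeta is trivial on the last bracket. *)
  set v := (x0 ^+ 2 + a) / x0 ^+ 2.
  have v0 : v != 0 by rewrite mulf_neq0 ?invr_eq0 ?expf_neq0.
  have -> : a / x0 ^+ 2 = v + 1.
    have -> : v = a / x0 ^+ 2 + 1 by rewrite /v; field.
    by rewrite -addrA addxx addr0.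
  have -> : a ^+ 3 / b ^+ 2 = v + 1 + (v^-1 + v^-1 ^+ 2).
    have -> : a = x0 ^+ 2 * (v + 1).
      have -> : v + 1 = a / x0 ^+ 2 + 2%:R by rewrite /v; field.
      by rewrite two0 addr0; field.
    have -> : b = x0 ^+ 3 * v by rewrite bE' /v; field.
    have -> : (x0 ^+ 2 * (v + 1)) ^+ 3 / (x0 ^+ 3 * v) ^+ 2 =
       v + 1 + (v^-1 + v^-1 ^+ 2) + 2%:R * (1 + v^-1) by field; rewrite v0 x00.
    by rewrite two0 mul0r addr0.
  rewrite [LHS]zetaD [X in _ * X]zetaD zeta_sqr.
  by case: (zeta_pm v^-1) => ->; rewrite ?mulrNN !mulr1.
split=> //; rewrite zE.
have -> : [set x | x ^+ 3 + a * x + b == 0] =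
    x0 |: [set x | x ^+ 2 + x0 * x + (x0 ^+ 2 + a) == 0].
  apply/setP => x; rewrite !inE.
  have -> : x ^+ 3 + a * x + b = (x - x0) * (x ^+ 2 + x0 * x + (x0 ^+ 2 + a))
     + 2%:R * b by rewrite bE'; ring.
  by rewrite two0 mul0r addr0 mulf_eq0 subr_eq0.
rewrite cardsU1 inE.
have -> : x0 ^+ 2 + x0 * x0 + (x0 ^+ 2 + a) = x0 ^+ 2 + a + 2%:R * x0 ^+ 2 by ring.
rewrite two0 mul0r addr0 (negPf xa0) natrD card_quadratic //.
have -> : (x0 ^+ 2 + a) / x0 ^+ 2 = a / x0 ^+ 2 + 1 by field.
by rewrite zetaD zeta1 mulrN1 addrA.
Qed.

(** By the Artin-Schreier count, [zeta 1 = -1] excludes 1 from the values w^2 + w: F has no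
    primitive cube root of unity, which makes cubing injective. *)
Lemma no_cube_root1 (w : F) : w ^+ 2 + w != 1.
Proof.
apply/negP => h; have := card_artin_schreier 1; rewrite zeta1 subrr => /eqP.
by rewrite pnatr_eq0 cards_eq0 => /eqP/setP/(_ w); rewrite !inE h.
Qed.

Lemma cube_inj : injective (fun x : F => x ^+ 3).
Proof.
move=> x y /=; have [->|y0] := eqVneq y 0.
  by rewrite expr0n => /eqP; rewrite expf_eq0 => /eqP.
move=> e; pose w := x / y.
have : (w - 1) * (w ^+ 2 + w + 1) = 0.
  have -> : (w - 1) * (w ^+ 2 + w + 1) = w ^+ 3 - 1 by ring.
  by rewrite expr_div_n e divff ?subrr // expf_neq0.
move/eqP; rewrite mulf_eq0 subr_eq0 addx_eq0 (negPf (no_cube_root1 w)) orbF.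
by move=> /eqP w1; rewrite -[x](divfK y0) -/w w1 mul1r.
Qed.

(* The map [x -> x^3 + x] permutes the set [x <> 0, zeta (1/x) = 1]. *)
Lemma cubic_root_exists (a b : F) : b != 0 -> zeta (a ^+ 3 / b ^+ 2) = 1 ->
  exists x, x ^+ 3 + a * x + b = 0.
Proof.
move=> b0; have [-> _|a0 zab] := eqVneq a 0.
  have [g _ gK] := injF_bij cube_inj.
  by exists (g b); rewrite gK mul0r addr0 addxx.
(* With a = c^2, the scaling x -> c x reduces the cubic to x^3 + x + b / c^3. *)
pose c := fsqrt a; have cE : c ^+ 2 = a by exact: fsqrtK.
have c0 : c != 0 by apply: contra a0 => /eqP cz; rewrite -cE cz expr0n.
pose Z := [set x : F | (x != 0) && (zeta x^-1 == 1)].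
pose g (x : F) := x ^+ 3 + x.
have rootg x : x ^+ 3 + 1 * x + g x = 0 by rewrite mul1r addxx.
have gE x : g x = x * (x + 1) ^+ 2.
  have -> : x * (x + 1) ^+ 2 = g x + 2%:R * x ^+ 2 by rewrite /g; ring.
  by rewrite two0 mul0r addr0.
have Zg x : x \in Z -> g x != 0.
  rewrite inE gE => /andP[x0 /eqP zx]; rewrite mulf_neq0 // expf_neq0 //.
  rewrite addx_eq0; apply: contra one_neqN1 => /eqP x1.
  by rewrite -[X in X == _]zx x1 invr1 zeta1.
have zg x : x \in Z -> zeta (1 ^+ 3 / g x ^+ 2) = 1.
  move=> Zx; have [_ ->] := card_cubic_root (Zg x Zx) (rootg x).
  by move: Zx; rewrite inE div1r -exprVn zeta_sqr => /andP[_ /eqP].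
have gZ : {homo g : x / x \in Z}.
  move=> x Zx; rewrite inE Zg //=; have := zg x Zx.
  by rewrite expr1n div1r -exprVn zeta_sqr => ->.
(* For x in Z the cubic with constant term g x has 2 - 1 = 1 root, which is x. *)
have ginj : {in Z &, injective g}.
  move=> x y Zx Zy exy; have [+ _] := card_cubic_root (Zg x Zx) (rootg x).
  rewrite (zg x Zx) -(natrB _ (isT : 1 <= 2)%N) => /eqP; rewrite eqr_nat => /cards1P[z zE].
  have: x \in [set z]  by rewrite -zE inE rootg.
  have: y \in [set z]  by rewrite -zE inE exy rootg.
  by rewrite !inE => /eqP-> /eqP->.
have gim : g @: Z = Z.
  apply/eqP; rewrite eqEcard card_in_imset // leqnn andbT.
  by apply/subsetP => _ /imsetP[x Zx ->]; exact: gZ.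
pose e := b / c ^+ 3.
have : e \in Z.
  rewrite inE mulf_neq0 ?invr_eq0 ?expf_neq0 //= -zeta_sqr -zab -cE.
  by apply/eqP; congr zeta; rewrite /e; field; rewrite b0 c0.
rewrite -gim => /imsetP[x _ eE]; exists (c * x).
have -> : b = c ^+ 3 * e by rewrite /e; field.
rewrite eE /g -[a in LHS]cE.
have -> : (c * x) ^+ 3 + c ^+ 2 * (c * x) + c ^+ 3 * (x ^+ 3 + x) =
  2%:R * (c ^+ 3 * (x ^+ 3 + x)) by ring.
by rewrite two0 mul0r.
Qed.

Lemma card_cubic (a b : F) : b != 0 ->
  let n := #|[set x | x ^+ 3 + a * x + b == 0]| in
  (n = 1%N /\ zeta (a ^+ 3 / b ^+ 2) = 1) \/
  ((n = 0%N \/ n = 3%N) /\ zeta (a ^+ 3 / b ^+ 2) = -1).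
Proof.
move=> b0 n; have [n0|[x]] := set_0Vmem [set x | x ^+ 3 + a * x + b == 0].
  right; split; first by left; rewrite /n n0 cards0.
  apply: zeta_neq => /(cubic_root_exists b0)[x xr].
  by move/setP/(_ x): n0; rewrite !inE xr eqxx.
rewrite inE => /eqP /(card_cubic_root b0)[]; rewrite -/n.
case: (zeta_pm (a ^+ 3 / b ^+ 2)) => -> nE _; [left|right]; split=> //.
  by apply/eqP; rewrite -(eqr_nat C) nE -(natrB _ (isT : 1 <= 2)%N).
by right; apply/eqP; rewrite -(eqr_nat C) nE opprK natr1.
Qed.

Lemma card_gt0_F : (0 < #|F|)%N.
Proof. by apply/card_gt0P; exists 0. Qed.

(** * The kernel cubic and the transform of [rootless] *)

(** Here z stands for w^4, w a nonzero element of the kernel governing |S|^2, and [a] for the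
    residue of the middle coordinate. *)
Definition cubic_roots (a b : F) := [set z | b ^+ 2 * z ^+ 3 + a ^+ 4 * z + b == 0].
Definition rootless (a b : F) := (b != 0) && (cubic_roots a b == set0).

Lemma cubic_roots_neq0 (a b z : F) : b != 0 -> z \in cubic_roots a b -> z != 0.
Proof.
move=> b0; rewrite inE => /eqP zr; apply: contra b0 => /eqP z0.
by move: zr; rewrite z0 expr0n /= !mulr0 !add0r => /eqP.
Qed.

Lemma card_cubic_roots (a b : F) : b != 0 ->
  (#|cubic_roots a b| = 1%N /\ zeta (a ^+ 3 / b) = 1) \/
  ((#|cubic_roots a b| = 0%N \/ #|cubic_roots a b| = 3%N) /\ zeta (a ^+ 3 / b) = -1).
Proof.
move=> b0; have bV0 : b^-1 != 0 by rewrite invr_eq0.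
have -> : zeta (a ^+ 3 / b) = zeta ((a ^+ 4 / b ^+ 2) ^+ 3 / b^-1 ^+ 2).
  by rewrite -[LHS]zeta_X4; congr zeta; field; rewrite b0 oner_neq0.
have -> : #|cubic_roots a b| = #|[set x | x ^+ 3 + a ^+ 4 / b ^+ 2 * x + b^-1 == 0]|.
  apply: eq_card => x; rewrite !inE -[RHS](inj_eq (mulfI (expf_neq0 2 b0))) mulr0.
  by congr (_ == _); field.
exact: card_cubic.
Qed.

(* The right-hand side interpolates at the possible root counts 0, 1 and 3. *)
Lemma rootlessE (a b : F) : b != 0 ->
  3%:R * (rootless a b)%:R = 2%:R - #|cubic_roots a b|%:R - zeta (a ^+ 3 / b).
Proof.
move=> b0; rewrite /rootless b0 -cards_eq0.
by case: (card_cubic_roots a b0) => [[-> ->]|[[]-> ->]] /=; ring.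
Qed.

Definition rootless_hat (be B : F) : C :=
  \sum_b \sum_a (rootless a b)%:R * zeta (a * be + b * B).

(** [quad_roots] and [dual_roots] collect the parameters at which an exponent that has been made
    linear in b vanishes identically. They come from the two nonconstant terms of [rootlessE]. *)
Definition quad_roots (be B : F) :=
  [set z | (z != 0) && (be ^+ 4 + be ^+ 2 * z ^+ 2 + B * z == 0)].
Definition dual_roots (be B : F) := [set v | v ^+ 3 + be * v ^+ 2 + B == 0].

(** For b and z nonzero, z is a root for exactly one a, the one with a^4 = b / z + b^2 z^2. As zeta
    is invariant under squaring, zeta (a be) = zeta (a^4 be^4) can be rewritten with an exponent
    linear in b, and orthogonality applies. *)
Lemma sum_cubic_roots (be B : F) :
  \sum_(b | b != 0) \sum_a #|cubic_roots a b|%:R * zeta (a * be + b * B)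
  = q * #|quad_roots be B|%:R - (q - 1).
Proof.
transitivity (\sum_(b | b != 0) \sum_(z | z != 0)
    zeta (b * (be ^+ 4 / z + be ^+ 2 * z + B))).
  apply: eq_bigr => b b0.
  transitivity (\sum_(a : F) \sum_(z | z \in cubic_roots a b) zeta (a * be + b * B)).
    by apply: eq_bigr => a _; rewrite sumr_const mulr_natl.
  rewrite (exchange_big_dep (fun z => z != 0)) /=; last first.
    by move=> a z _; exact: cubic_roots_neq0.
  apply: eq_bigr => z z0.
  pose a0 := fsqrt (fsqrt (b / z + b ^+ 2 * z ^+ 2)).
  have a0E : a0 ^+ 4 = b / z + b ^+ 2 * z ^+ 2.
    by rewrite (exprM _ 2 2) !fsqrtK.
  rewrite (big_pred1 a0) => [|a /=]; last first.
    rewrite inE -[RHS](inj_eq sqr_inj) /= -[RHS](inj_eq sqr_inj) /= -!exprM -[(2 * 2)%N]/4%N a0E.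
    rewrite -[RHS]addx_eq0 -[RHS](inj_eq (mulfI z0)) mulr0; congr (_ == _).
    have -> : z * (a ^+ 4 + (b / z + b ^+ 2 * z ^+ 2)) =
      z * a ^+ 4 + b + b ^+ 2 * z ^+ 3 by field.
    by ring.
  rewrite zetaD -[zeta (a0 * be)]zeta_X4 exprMn a0E -zetaD.
  rewrite -[LHS]mulr1 -zeta0.
  have -> : b * (be ^+ 4 / z + be ^+ 2 * z + B) =
    b * be ^+ 4 / z + b * be ^+ 2 * z + b * B by field.
  rewrite mulrDl !zetaD.
  rewrite zeta0 mulr1; congr (_ * _ * _).
    by congr zeta; field.
  by rewrite -[RHS]zeta_sqr; congr zeta; ring.
rewrite exchange_big /=.
transitivity (\sum_(z : F | z != 0)
    ((if be ^+ 4 / z + be ^+ 2 * z + B == 0 then q else 0) - 1)).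
  by apply: eq_bigr => z _; rewrite sum_zeta_neq0.
rewrite sumrB; congr (_ - _).
  rewrite -big_mkcondr /= (eq_bigl (mem (quad_roots be B))) => [|z] /=.
    by rewrite sumr_const mulr_natr.
  rewrite inE; have [//|z0] := eqVneq z 0.
  rewrite -[LHS](inj_eq (mulfI z0)) mulr0 /=; congr (_ == _); field.
  by rewrite z0.
rewrite sumr_const cardC1 -subn1 natrB //; exact: card_gt0_F.
Qed.

(** The substitution a = b v^2 turns a^3 / b into (b v^3)^2, on which zeta agrees with b v^3: the
    exponent is again linear in b. *)
Lemma sum_dual_roots (be B : F) :
  \sum_(b | b != 0) \sum_a zeta (a ^+ 3 / b) * zeta (a * be + b * B)
  = q * #|dual_roots be B|%:R - q.
Proof.
transitivity (\sum_(b | b != 0) \sum_v zeta (b * (v ^+ 3 + be * v ^+ 2 + B))).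
  apply: eq_bigr => b b0.
  rewrite (reindex_inj (inj_comp (mulfI b0) sqr_inj)) /=; apply: eq_bigr => v _.
  rewrite -zetaD.
  have -> : (b * v ^+ 2) ^+ 3 / b + (b * v ^+ 2 * be + b * B) =
     (b * v ^+ 3) ^+ 2 + (b * (be * v ^+ 2) + b * B) by field.
  by rewrite zetaD zeta_sqr -zetaD; congr zeta; ring.
rewrite exchange_big /=.
transitivity (\sum_v ((if v ^+ 3 + be * v ^+ 2 + B == 0 then q else 0) - 1)).
  by apply: eq_bigr => v _; rewrite sum_zeta_neq0.
rewrite sumrB sumr_const; congr (_ - _).
rewrite -big_mkcond /= (eq_bigl (mem (dual_roots be B))) => [|z] /=.
  by rewrite sumr_const mulr_natr.
by rewrite inE.
Qed.

Lemma rootless_hatE (be B : F) :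
  3%:R * rootless_hat be B =
    2%:R * ((if be == 0 then q else 0) * ((if B == 0 then q else 0) - 1))
    + (2%:R * q - 1) - q * (#|quad_roots be B| + #|dual_roots be B|)%:R.
Proof.
rewrite /rootless_hat mulr_sumr (bigD1 0) //= [X in _ + X = _](eq_bigr (fun b =>
   2%:R * (\sum_a zeta (a * be)) * zeta (b * B)
   - \sum_a #|cubic_roots a b|%:R * zeta (a * be + b * B)
   - \sum_a zeta (a ^+ 3 / b) * zeta (a * be + b * B))); last first.
  move=> b b0; rewrite mulr_sumr -mulrA mulr_suml mulr_sumr -!sumrB.
  apply: eq_bigr => a _; rewrite mulrA rootlessE // !mulrBl -zetaD //.
rewrite big1 ?mulr0 ?add0r => [|a _]; last by rewrite /rootless eqxx mul0r.
rewrite !sumrB sum_cubic_roots sum_dual_roots -mulr_sumr sum_zeta_neq0 sum_zeta.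
by rewrite natrD; case: (be == 0); case: (B == 0); ring.
Qed.

Lemma card_dual_roots0 (B : F) : #|dual_roots 0 B| = 1%N.
Proof.
have [g _ gK] := injF_bij cube_inj.
rewrite -(cards1 (g B)); apply: eq_card => v; rewrite !inE mul0r addr0.
by rewrite addx_eq0 -[RHS](inj_eq cube_inj) /= gK.
Qed.

Lemma card_quad_roots0 (B : F) : B != 0 -> #|quad_roots 0 B| = 0%N.
Proof.
move=> B0; apply/eqP; rewrite cards_eq0; apply/eqP/setP => z.
by rewrite !inE !expr0n mul0r !add0r mulf_eq0 (negPf B0) /= andNb.
Qed.

(* For [B <> 0] the quadratic has its two roots exactly when
   [zeta (be^3/B) = 1], in which case the (reciprocal) cubic has one root. *)
Lemma card_quad_dual_roots (be B : F) : be != 0 ->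
  (#|quad_roots be B| + #|dual_roots be B| = if dual_roots be B == set0 then 0 else 3)%N.
Proof.
move=> be0; have [->|B0] := eqVneq B 0.
  have -> : quad_roots be 0 = [set be].
    apply/setP => z; rewrite !inE mul0r addr0.
    have -> : be ^+ 4 + be ^+ 2 * z ^+ 2 = (be * (be + z)) ^+ 2 - 2%:R * (be ^+ 3 * z) by ring.
    rewrite two0 mul0r subr0 expf_eq0 /= mulf_eq0 (negPf be0) addx_eq0 /= [be == z]eq_sym.
    by case: (z =P be) => [->|]; rewrite ?be0 ?andbF.
  have -> : dual_roots be 0 = [set 0; be].
    apply/setP => z; rewrite !inE addr0.
    have -> : z ^+ 3 + be * z ^+ 2 = z ^+ 2 * (z + be) by ring.
    by rewrite mulf_eq0 expf_eq0 addx_eq0.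
  rewrite cards1 cards2 eq_sym be0 ifN //; apply/set0Pn; exists 0.
  by rewrite !inE eqxx.
have quadE : #|quad_roots be B|%:R = 1 + zeta (be ^+ 3 / B).
  have -> : zeta (be ^+ 3 / B) = zeta (be ^+ 2 / (B / be ^+ 2) ^+ 2).
    by rewrite -[LHS]zeta_sqr; congr zeta; field; rewrite B0 be0.
  rewrite -card_quadratic ?mulf_neq0 ?invr_eq0 ?expf_neq0 //; congr (_%:R).
  apply: eq_card => z; rewrite !inE.
  have -> : be ^+ 4 + be ^+ 2 * z ^+ 2 + B * z =
    be ^+ 2 * (z ^+ 2 + B / be ^+ 2 * z + be ^+ 2) by field.
  rewrite mulf_eq0 expf_eq0 (negPf be0) /=.
  case: eqP => [->|//]; rewrite expr0n mulr0 !add0r expf_eq0 (negPf be0).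
  by rewrite andbF.
have dualE : #|dual_roots be B| = #|[set x | x ^+ 3 + be / B * x + B^-1 == 0]|.
  rewrite -[RHS](card_imset _ (@invr_inj F)); apply: eq_card => v; rewrite inE.
  have vE x : x != 0 -> (x ^+ 3 + be * x ^+ 2 + B == 0) =
     (x^-1 ^+ 3 + be / B * x^-1 + B^-1 == 0).
    move=> x0; have c0 : (B * x^-1 ^+ 3) != 0 by rewrite mulf_neq0 ?expf_neq0 ?invr_eq0.
    rewrite -[RHS](inj_eq (mulfI B0)) -[RHS](inj_eq (mulfI (expf_neq0 3 x0))) !mulr0.
    by congr (_ == _); field; rewrite B0 x0.
  apply/idP/imsetP => [vr|[x xr ->]].
    have v0 : v != 0.
      by apply: contraTN vr => /eqP->; rewrite !expr0n mulr0 !add0r.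
    by exists v^-1; rewrite ?invrK // inE -vE.
  have x0 : x != 0.
    apply: contraTN xr => /eqP->; rewrite inE expr0n mulr0 !add0r.
    by rewrite invr_eq0.
  by rewrite vE ?invr_eq0 // invrK; rewrite inE in xr.
rewrite -cards_eq0 dualE.
have := card_cubic (be / B) (invr_neq0 B0).
have -> : zeta ((be / B) ^+ 3 / B^-1 ^+ 2) = zeta (be ^+ 3 / B).
  by congr zeta; field; rewrite B0 oner_neq0.
move=> /= [[-> zE]|[nE zE]].
  suff -> : #|quad_roots be B| = 2%N by [].
  by apply/eqP; rewrite -(eqr_nat C) quadE zE.
suff -> : #|quad_roots be B| = 0%N by case: nE => ->.
by apply/eqP; rewrite -(eqr_nat C) quadE zE subrr.
Qed.

(** The map v^3 + v^2 vanishes at both 0 and 1, so it is not injective on the finite field, hence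
    not onto. This makes the dual cells given by a rootless dual cubic nonempty. *)
Lemma exists_dual_rootless : exists B, dual_roots 1 B = set0.
Proof.
have /existsP[B hB] : [exists B, dual_roots 1 B == set0]; last by exists B; exact/eqP.
apply: contraT; rewrite negb_exists => /forallP h.
pose g (v : F) := v ^+ 3 + v ^+ 2.
have gsurj B : B \in [set g v | v in F].
  have /set0Pn[v] := h B; rewrite inE mul1r addx_eq0 => /eqP <-.
  exact: imset_f.
have /imset_injP ginj : #|[set g v | v in F]| == #|F|.
  by rewrite -cardsT; apply/eqP/eq_card => B; rewrite gsurj inE.
have := ginj 0 1 isT isT; rewrite /g !expr0n !expr1n /= !addxx => /(_ erefl) /eqP.
by rewrite eq_sym oner_eq0.
Qed.

End BinaryField.

(** * Duality for translation schemes *)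

Section TranslationDuality.
Variables (G : finZmodType) (C : numFieldType) (chi : G -> G -> C).
Hypothesis chi_sym : forall g y, chi g y = chi y g.
Hypothesis chiDl : forall y, {morph chi^~ y : g h / g + h >-> g * h}.
Hypothesis chi0l : forall y, chi 0 y = 1.
Hypothesis chi_nondeg : forall y, y != 0 -> exists g, chi g y != 1.
Local Notation N := (#|G|%:R : C).

Definition hat (phi : G -> C) (y : G) : C := \sum_g phi g * chi g y.

Lemma chiDr g : {morph chi g : y z / y + z >-> y * z}.
Proof. by move=> y z; rewrite !(chi_sym g) chiDl. Qed.

Lemma chi0r g : chi g 0 = 1. Proof. by rewrite chi_sym chi0l. Qed.

Lemma sum_chi y : \sum_g chi g y = if y == 0 then N else 0.
Proof.
case: eqP => [->|/eqP/chi_nondeg[h hy]].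
  by rewrite (eq_bigr (fun=> 1)) ?sumr_const // => g _; rewrite chi0r.
set s := LHS; have : s * (chi h y - 1) = 0.
  rewrite mulrBr mulr1 mulr_suml /s [X in _ - X](reindex_inj (addIr h)) /=.
  by rewrite -sumrB big1 // => g _; rewrite chiDl subrr.
by move/eqP; rewrite mulf_eq0 subr_eq0 (negPf hy) orbF => /eqP.
Qed.

Lemma card_neq0 : N != 0.
Proof. by rewrite pnatr_eq0 -lt0n; apply/card_gt0P; exists 0. Qed.

Lemma hat_mul_chi (phi : G -> C) w y :
  hat (fun g => phi g * chi g w) y = hat phi (y + w).
Proof.
by apply: eq_bigr => g _; rewrite chiDr -mulrA [chi g w * _]mulrC.
Qed.

Lemma eq_hat (phi psi : G -> C) : phi =1 psi -> hat phi =1 hat psi.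
Proof. by move=> e y; apply: eq_bigr => g _; rewrite e. Qed.

Lemma hatD (phi psi : G -> C) y :
  hat (fun g => phi g + psi g) y = hat phi y + hat psi y.
Proof. by rewrite -big_split; apply: eq_bigr => g _ /=; rewrite mulrDl. Qed.

Lemma hatZ c (phi : G -> C) y : hat (fun g => c * phi g) y = c * hat phi y.
Proof. by rewrite mulr_sumr; apply: eq_bigr => g _ /=; rewrite mulrA. Qed.

Lemma hat_inv (phi : G -> C) g :
  \sum_y hat phi y * chi (- g) y = N * phi g.
Proof.
transitivity (\sum_h \sum_y phi h * chi (h - g) y).
  rewrite exchange_big /=; apply: eq_bigr => y _; rewrite mulr_suml.
  by apply: eq_bigr => h _; rewrite chiDl mulrA.
rewrite (bigD1 g) //= [X in _ + X]big1 => [|h hg].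
  rewrite addr0 -mulr_sumr subrr (eq_bigr (fun=> 1)) => [|y _]; last exact: chi0l.
  by rewrite sumr_const mulrC.
rewrite -mulr_sumr (eq_bigr (chi^~ (h - g))) => [|y _]; last by rewrite chi_sym.
by rewrite sum_chi subr_eq0 (negPf hg) mulr0.
Qed.

Lemma convolution_hat (phi psi : G -> C) g :
  N * \sum_h phi (g - h) * psi h = \sum_y hat phi y * hat psi y * chi (- g) y.
Proof.
transitivity (\sum_h psi h * \sum_y hat phi y * chi (- (g - h)) y).
  rewrite mulr_sumr; apply: eq_bigr => h _; rewrite hat_inv.
  by rewrite mulrA mulrC.
under eq_bigr do rewrite mulr_sumr.
rewrite exchange_big /=; apply: eq_bigr => y _.
rewrite -mulrA [hat psi y * _]mulrC mulrA mulr_sumr.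
apply: eq_bigr => h _; rewrite opprB addrC chiDl; ring.
Qed.

Section Classes.
Variables (n : nat) (cl cl' : G -> 'I_n).

Definition clsfun (c : G -> 'I_n) (phi : G -> C) :=
  forall g h, c g = c h -> phi g = phi h.
Definition ind (c : G -> 'I_n) (i : 'I_n) (g : G) : C := (c g == i)%:R.

(** The two inclusions behind the exchange of class functions: transforms of class functions are
    dual class functions, and every dual class function is such a transform. Both conditions are
    stable under linear combination, so spanning families suffice. *)
Definition dualfun (phi : G -> C) := clsfun cl phi /\ clsfun cl' (hat phi).
Definition dualimg (psi : G -> C) := exists2 phi, clsfun cl phi & hat phi =1 psi.

Lemma eq_dualfun phi psi : phi =1 psi -> dualfun phi -> dualfun psi.
Proof.
move=> e [cphi chphi]; split=> g h egh; first by rewrite -!e; exact: cphi.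
by rewrite -!(eq_hat e); exact: chphi.
Qed.

Lemma dualfunD phi psi :
  dualfun phi -> dualfun psi -> dualfun (fun g => phi g + psi g).
Proof.
move=> [cphi chphi] [cpsi chpsi]; split=> g h egh.
  by rewrite (cphi g h) // (cpsi g h).
by rewrite !hatD (chphi g h) // (chpsi g h).
Qed.

Lemma dualfunZ c phi : dualfun phi -> dualfun (fun g => c * phi g).
Proof.
move=> [cphi chphi]; split=> g h egh; first by rewrite (cphi g h).
by rewrite !hatZ (chphi g h).
Qed.

Lemma dualfun_hat phi : dualfun phi -> dualimg (hat phi).
Proof. by case=> cphi _; exists phi. Qed.

Lemma eq_dualimg phi psi : phi =1 psi -> dualimg phi -> dualimg psi.
Proof. by move=> e [a ca ha]; exists a => // y; rewrite ha e. Qed.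

Lemma dualimgD phi psi :
  dualimg phi -> dualimg psi -> dualimg (fun g => phi g + psi g).
Proof.
move=> [a ca ha] [b cb hb]; exists (fun g => a g + b g) => [g h e|y].
  by rewrite (ca g h) // (cb g h).
by rewrite hatD ha hb.
Qed.

Lemma dualimgZ c phi : dualimg phi -> dualimg (fun g => c * phi g).
Proof.
move=> [a ca ha]; exists (fun g => c * a g) => [g h e|y].
  by rewrite (ca g h).
by rewrite hatZ ha.
Qed.

Hypothesis ind_dual : forall i, dualfun (ind cl i).
Hypothesis ind_img : forall c, dualimg (ind cl' c).
Hypothesis cl'_surj : forall c, exists y, cl' y = c.

(** Up to the factor N, the convolution is the inverse transform of a product that is constant on
    dual cells. That product is a combination of dual indicators, each the transform of a class
    function. *)
Lemma convolution_clsfun i j :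
  clsfun cl (fun g => \sum_h ind cl i (g - h) * ind cl j h).
Proof.
have [rep repE] := fin_all_exists cl'_surj.
have img c : exists phi, clsfun cl phi /\ hat phi =1 ind cl' c.
  by case: (ind_img c) => phi ? ?; exists phi.
have [phi phiP] := fin_all_exists img.
move=> g h egh; apply: (mulfI card_neq0); rewrite !convolution_hat.
have E k : \sum_y hat (ind cl i) y * hat (ind cl j) y * chi (- k) y
    = \sum_c hat (ind cl i) (rep c) * hat (ind cl j) (rep c) * (N * phi c k).
  under [RHS]eq_bigr do rewrite -hat_inv mulr_sumr.
  rewrite exchange_big /=; apply: eq_bigr => y _.
  rewrite (bigD1 (cl' y)) //= big1 ?addr0 => [|c yc].
    have [_ ->] := phiP (cl' y); rewrite /ind eqxx mul1r.
    have [_ ci] := ind_dual i; have [_ cj] := ind_dual j.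
    by rewrite (ci (rep _) y) ?(cj (rep _) y) // repE.
  have [_ ->] := phiP c; rewrite /ind eq_sym (negPf yc) mul0r mulr0 //.
rewrite !E; apply: eq_bigr => c _; have [cphi _] := phiP c.
by rewrite (cphi g h).
Qed.

(** The transforms of the class indicators, sampled at one point per dual cell, form a square matrix
    P with a left inverse Q. Then P Q = 1 too, so P has no zero row, whereas an empty class would
    give one. *)
Lemma cl_surj i : exists g, cl g = i.
Proof.
have /existsP[g /eqP gi] : [exists g, cl g == i]; last by exists g.
apply: contraT; rewrite negb_exists => /forallP noi.
have [rep repE] := fin_all_exists cl'_surj.
have img c : exists phi, clsfun cl phi /\ hat phi =1 ind cl' c.
  by case: (ind_img c) => phi ? ?; exists phi.
have [phi phiP] := fin_all_exists img.
pose P : 'M[C]_n := \matrix_(k, d) hat (ind cl k) (rep d).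
(* The default 0 is taken only for an empty class, which contributes nothing to Q P. *)
pose Q : 'M[C]_n := \matrix_(c, k) phi c (odflt 0 [pick g | cl g == k]).
have QP : Q *m P = 1%:M.
  apply/matrixP => c d; rewrite !mxE.
  have [cphi hphi] := phiP c.
  have -> : (c == d)%:R = ind cl' c (rep d) by rewrite /ind repE eq_sym.
  rewrite -hphi; under eq_bigr do rewrite !mxE mulr_sumr.
  rewrite exchange_big /=; apply: eq_bigr => g _.
  rewrite (bigD1 (cl g)) //= big1 ?addr0 => [|k gk].
    rewrite /ind eqxx mul1r; congr (_ * _); apply: cphi.
    by case: pickP => [h /eqP //|/(_ g)]; rewrite eqxx.
  by rewrite /ind eq_sym (negPf gk) mul0r mulr0.
have /matrixP/(_ i i) := mulmx1C QP; rewrite !mxE eqxx big1 => [/esym/eqP|k _].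
  by rewrite oner_eq0.
rewrite !mxE /hat big1 ?mul0r // => g _.
by rewrite /ind (negPf (noi g)) mul0r.
Qed.

End Classes.
End TranslationDuality.

(** * Weights of the codewords *)

HB.instance Definition _ (U V : finZmodType) := GRing.Zmodule.on (U * V)%type.

(** Descent: when 4 divides x^2 + y^2, both x and y are even. Only x is described because only the
    real part of S affects the weight. *)
Lemma sum_sqr_pow2 (n x y : nat) :
  ((x ^ 2 + y ^ 2 = 2 ^ n.*2 -> x = 0 \/ x = 2 ^ n) /\
   (x ^ 2 + y ^ 2 = 2 ^ n.*2.+1 -> x = 2 ^ n))%N.
Proof.
elim: n x y => [|n IHn] x y.
  by split; case: x => [|[|x]]; case: y => [|[|y]] => //; rewrite ?expn0 ?expn1; nia.
have even2 k : (x ^ 2 + y ^ 2 = 4 * k)%N -> exists x' y', x = x'.*2 /\ y = y'.*2.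
  move=> e; exists x./2, y./2.
  move: e; rewrite -(odd_double_half x) -(odd_double_half y).
  by case: (odd x); case: (odd y); rewrite -!muln2; nia.
have pw k : (2 ^ k.+2 = 4 * 2 ^ k)%N by rewrite !expnS mulnA.
split; rewrite doubleS pw => e; have [x' [y' [xE yE]]] := even2 _ e.
- have /(IHn x' y').1[] : (x' ^ 2 + y' ^ 2 = 2 ^ n.*2)%N.
    by move: e; rewrite xE yE -!muln2; nia.
  + by move=> x0; left; rewrite xE x0.
  + by move=> x0; right; rewrite xE x0 expnS mul2n.
- have /(IHn x' y').2 x'E : (x' ^ 2 + y' ^ 2 = 2 ^ n.*2.+1)%N.
    by move: e; rewrite xE yE -!muln2; nia.
  by rewrite xE x'E expnS mul2n.
Qed.

Ltac case10 x := case: x => [[|[|[|[|[|[|[|[|[|[|?]]]]]]]]]] ?] //=.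

(** * Fourth roots of unity and Lee weights *)

Section QuarterTurn.
Variable C : numClosedFieldType.

Definition chi4 (k : 'Z_4) : C := 'i ^+ val k.

Lemma chi4D : {morph chi4 : k l / k + l >-> k * l}.
Proof.
move=> k l; rewrite /chi4 -exprD /= [in RHS](divn_eq (k + l) 4) exprD mulnC exprM.
by rewrite (exprM _ 2 2) sqrCi sqrrN !expr1n mul1r.
Qed.

Lemma chi40 : chi4 0 = 1. Proof. exact: expr0. Qed.

Lemma chi4_eq1 k : (chi4 k == 1) = (k == 0).
Proof.
apply/eqP/eqP => [|->]; last exact: chi40.
have i2 : 'i ^+ 2 = -1 :> C := sqrCi C.
have n1 : (-1 : C) <> 1 by move=> /esym/eqP; rewrite -subr_eq0 opprK (eqr_nat _ 2 0).
case: k => [[|[|[|[|]]]]] // lk; rewrite /chi4 /=.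
- by move=> _; exact: val_inj.
- by rewrite expr1 => i1; case: n1; rewrite -i2 i1 expr1n.
- by rewrite i2.
- rewrite exprS i2 mulrN1 => /eqP; rewrite eqr_oppLR => /eqP iE.
  by case: n1; rewrite -i2 iE sqrrN expr1n.
Qed.

(** The real part of i^k, which ties Lee weights to exponential sums; the imaginary part of i^k is
    the real part of i^(k-1). Integer values serve the sum of two squares argument. *)
Definition re4 (k : 'Z_4) : int := 1 - (leeZ4 k)%:Z.
Definition im4 (k : 'Z_4) : int := re4 (k - 1).

Lemma chi4E k : chi4 k = (re4 k)%:~R + 'i * (im4 k)%:~R.
Proof.
have i2 : 'i ^+ 2 = -1 :> C := sqrCi C.
case: k => [[|[|[|[|]]]]] // lk; rewrite /chi4 /=.
- have [-> ->] : re4 (Ordinal lk) = 1 /\ im4 (Ordinal lk) = 0 by split.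
  by rewrite expr0 mulr0 addr0.
- have [-> ->] : re4 (Ordinal lk) = 0 /\ im4 (Ordinal lk) = 1 by split.
  by rewrite add0r mulr1.
- have [-> ->] : re4 (Ordinal lk) = -1 /\ im4 (Ordinal lk) = 0 by split.
  by rewrite i2 mulr0 addr0.
- have [-> ->] : re4 (Ordinal lk) = 0 /\ im4 (Ordinal lk) = -1 by split.
  by rewrite exprS i2 add0r.
Qed.

Lemma re4N k : re4 (- k) = re4 k.
Proof. by case: k => [[|[|[|[|]]]]]. Qed.
Lemma im4N k : im4 (- k) = - im4 k.
Proof. by case: k => [[|[|[|[|]]]]]. Qed.

End QuarterTurn.

Section Words.
Variables (R : finComUnitRingType) (F : finFieldType) (m : nat).
Variables (pi : {rmorphism R -> F}) (tau : F -> R) (tr : R -> 'Z_4).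
Hypotheses (HT : teichmuller m pi tau tr) (m_odd : odd m) (m_ge3 : (3 <= m)%N).
Variable C : numClosedFieldType.
Local Notation q := (2 ^ m)%N.
Local Notation chi4 := (@chi4 C).

Let tauK := tm_tauK HT.
Let trD := tm_trD HT.

Lemma resF_two0 : 2%:R = 0 :> F.
Proof.
have /eqP : pi 4%:R = 0 by rewrite (tm_char4 HT) rmorph0.
by rewrite rmorph_nat (natrM _ 2 2) mulf_eq0 orbb => /eqP.
Qed.
Let two0 := resF_two0.

Lemma tr0 : tr 0 = 0.
Proof. by apply: (addrI (tr 0)); rewrite -trD !addr0. Qed.

Definition lam (x : F) : 'Z_4 := tr (2%:R * tau x).

Lemma lam_pi r : tr (2%:R * r) = lam (pi r).
Proof. by rewrite /lam (tm_two_tau HT). Qed.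

Lemma lamD : {morph lam : x y / x + y}.
Proof.
move=> x y; rewrite -trD -mulrDr lam_pi rmorphD !tauK //.
Qed.

Lemma lam_sqr x : lam (x ^+ 2) = lam x.
Proof.
by rewrite -[x in RHS]tauK -lam_pi -(tm_tr_sqr HT) lam_pi rmorphXn tauK.
Qed.

Lemma lam_X4 x : lam (x ^+ 4) = lam x.
Proof. by rewrite (exprM x 2 2) !lam_sqr. Qed.

Lemma lam1 : lam 1 = inZp 2.
Proof. by rewrite -(tm_tr2 HT) -[2%:R in RHS]mulr1 lam_pi rmorph1. Qed.

Lemma lam0 : lam 0 = 0.
Proof. by rewrite /lam (tm_tau0 HT) mulr0 tr0. Qed.

Definition zeta (x : F) : C := chi4 (lam x).

Lemma zetaD : {morph zeta : x y / x + y >-> x * y}.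
Proof. by move=> x y; rewrite /zeta lamD chi4D. Qed.
Lemma zeta_sqr x : zeta (x ^+ 2) = zeta x.
Proof. by rewrite /zeta lam_sqr. Qed.
Lemma zeta1 : zeta 1 = -1.
Proof. by rewrite /zeta lam1; exact: sqrCi. Qed.

Local Notation G := ('Z_4 * R * F)%type.

Definition pairing (g y : G) : 'Z_4 :=
  g.1.1 * y.1.1 + tr (g.1.2 * y.1.2) + lam (g.2 * y.2).
Definition chi (g y : G) : C := chi4 (pairing g y).

Lemma pairing_sym g y : pairing g y = pairing y g.
Proof.
by rewrite /pairing mulrC [g.1.2 * _]mulrC [g.2 * _]mulrC.
Qed.

Lemma pairingDl y : {morph pairing^~ y : g h / g + h}.
Proof.
move=> g h; rewrite /pairing /= !mulrDl trD lamD; ring.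
Qed.

Lemma pairing0l y : pairing 0 y = 0.
Proof. by rewrite /pairing /= !mul0r tr0 lam0 !addr0. Qed.

Lemma pairingNl g y : pairing (- g) y = - pairing g y.
Proof. by apply: (addrI (pairing g y)); rewrite -pairingDl !subrr pairing0l. Qed.

Lemma chi_sym g y : chi g y = chi y g.
Proof. by rewrite /chi pairing_sym. Qed.
Lemma chiDl y : {morph chi^~ y : g h / g + h >-> g * h}.
Proof. by move=> g h; rewrite /chi pairingDl chi4D. Qed.
Lemma chi0l y : chi 0 y = 1.
Proof. by rewrite /chi pairing0l chi40. Qed.

Lemma lam_nondeg b : b != 0 -> exists x, lam (x * b) != 0.
Proof. by move=> b0; exists b^-1; rewrite mulVf ?lam1. Qed.

Lemma chi_nondeg y : y != 0 -> exists g, chi g y != 1.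
Proof.
case: y => [[s A] B] y0; rewrite /chi /pairing /=.
have [s0|s0] := eqVneq s 0; last first.
  by exists (1, 0, 0) => /=; rewrite chi4_eq1 !mul0r tr0 lam0 !addr0 mul1r.
have [B0|/lam_nondeg[x xB]] := eqVneq B 0; last first.
  by exists (0, 0, x) => /=; rewrite chi4_eq1 !mul0r tr0 !add0r.
have A0 : A != 0 by apply: contra y0 => /eqP ->; rewrite s0 B0.
have /existsP[x xA] : [exists x, tr (A * x) != 0].
  apply: contraT; rewrite negb_exists => /forallP trA; case/negP: A0.
  by apply/eqP/(tm_tr_nondeg HT) => x; have := trA x; rewrite negbK => /eqP.
by exists (0, x, 0) => /=; rewrite chi4_eq1 !mul0r lam0 add0r addr0 mulrC.
Qed.

Definition epoint (x : F) : G := (1, tau x, x ^+ 3).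

Definition wsum (g : G) : C := \sum_x chi g (epoint x).
Definition wre (g : G) : int := \sum_x re4 (pairing g (epoint x)).
Definition wim (g : G) : int := \sum_x im4 (pairing g (epoint x)).

Lemma wsumE g : wsum g = (wre g)%:~R + 'i * (wim g)%:~R.
Proof.
rewrite !rmorph_sum mulr_sumr -big_split /=; apply: eq_bigr => x _.
exact: chi4E.
Qed.

Lemma wreN g : wre (- g) = wre g.
Proof. by apply: eq_bigr => x _; rewrite pairingNl re4N. Qed.

Lemma wimN g : wim (- g) = - wim g.
Proof. by rewrite -sumrN; apply: eq_bigr => x _; rewrite pairingNl im4N. Qed.

(** [wsum (- g)] is the complex conjugate of [wsum g], so the product is |S|^2. *)
Lemma wsum_norm g :
  wsum g * wsum (- g) = (`|wre g| ^ 2 + `|wim g| ^ 2)%N%:R.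
Proof.
have absE (k : int) : (`|k| ^ 2)%N%:R = k%:~R ^+ 2 :> C.
  rewrite natrX natr_absz -!rmorphXn; congr (_%:~R).
  by rewrite rmorphXn /= abszE real_normK ?num_real.
rewrite !wsumE wreN wimN rmorphN natrD !absE mulrN mulrC -subr_sqr exprMn sqrCi.
by rewrite mulN1r opprK.
Qed.

Lemma pairing_epoint u a b x :
  pairing (u, a, b) (epoint x) = u + tr (a * tau x) + lam (b * x ^+ 3).
Proof. by rewrite /pairing /= mulr1. Qed.

(* [x = y^2 + w^4] and [b = c^4]: the fourth powers turn the shift of the cubic
   form into a linear form in [y]. *)
Lemma pairing_shift u a b y w : let c := fsqrt two0 (fsqrt two0 b) in
  pairing (u, a, b) (epoint (y ^+ 2 + w ^+ 4)) =
  pairing (u, a, b) (epoint (y ^+ 2)) + pairing (0, a, b) (epoint (w ^+ 4))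
  + lam (y * (c ^+ 2 * w ^+ 4 + pi a * w ^+ 2 + c * w)).
Proof.
move=> c; have bE : b = c ^+ 4 by rewrite (exprM _ 2 2) !fsqrtK.
rewrite !pairing_epoint.
have -> : tau (y ^+ 2 + w ^+ 4) =
    tau (y ^+ 2) + tau (w ^+ 4) + 2%:R * (tau y * tau (w ^+ 2)).
  have -> : y ^+ 2 + w ^+ 4 = (y + w ^+ 2) ^+ 2 - 2%:R * (y * w ^+ 2) by ring.
  rewrite two0 mul0r subr0 (tm_tau_sqrD HT) (exprM w 2 2) !(expr2, tm_tauM HT).
  by ring.
rewrite !mulrDr !trD [a * (2%:R * _)]mulrCA lam_pi !rmorphM !tauK.
have -> : b * (y ^+ 2 + w ^+ 4) ^+ 3 = b * (y ^+ 2) ^+ 3 + b * (w ^+ 4) ^+ 3 +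
   ((c * y * w) ^+ 4 + (c ^+ 2 * y * w ^+ 4) ^+ 2)
   + 2%:R * b * y ^+ 2 * w ^+ 4 * (y ^+ 2 + w ^+ 4).
  rewrite bE; ring.
rewrite two0 !mul0r addr0 !lamD lam_X4 lam_sqr.
have -> : y * (c ^+ 2 * w ^+ 4) = c ^+ 2 * y * w ^+ 4 by ring.
have -> : y * (pi a * w ^+ 2) = pi a * (y * w ^+ 2) by ring.
have -> : y * (c * w) = c * y * w by ring.
ring.
Qed.

(** The factor of y in [pairing_shift]. The exponents 4, 2, 1 make it additive in w, so its kernel
    is a subgroup of F. *)
Definition shift_form (a : R) (b w : F) : F :=
  fsqrt two0 (fsqrt two0 b) ^+ 2 * w ^+ 4 + pi a * w ^+ 2 + fsqrt two0 (fsqrt two0 b) * w.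
Definition shift_ker a b := [set w | shift_form a b w == 0].

Lemma sqrD (x y : F) : (x + y) ^+ 2 = x ^+ 2 + y ^+ 2.
Proof. by rewrite sqrrD -mulr_natl two0 mul0r addr0. Qed.

Lemma X4D (x y : F) : (x + y) ^+ 4 = x ^+ 4 + y ^+ 4.
Proof. by rewrite !(exprM _ 2 2) !sqrD. Qed.

Lemma X4_inj : injective (fun x : F => x ^+ 4).
Proof. by move=> x y /=; rewrite !(exprM _ 2 2) => /(sqr_inj two0)/(sqr_inj two0). Qed.

Lemma fsqrt2X4 (b : F) : fsqrt two0 (fsqrt two0 b) ^+ 4 = b.
Proof. by rewrite (exprM _ 2 2) !fsqrtK. Qed.

Lemma shift_formD a b : {morph shift_form a b : w v / w + v}.
Proof. move=> w v; rewrite /shift_form X4D sqrD; ring. Qed.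

(** Weyl differencing with the two points written y^2 and y^2 + w^4: for fixed w the phase depends
    on y only through a linear term, and the sum over y is q on the kernel and 0 elsewhere. *)
Lemma wsum_norm_ker u a b :
  wsum (u, a, b) * wsum (- (u, a, b)) =
  #|F|%:R * \sum_(w in shift_ker a b) chi (0, a, b) (epoint (w ^+ 4)).
Proof.
transitivity (\sum_y \sum_w chi (0, a, b) (epoint (w ^+ 4)) * zeta (y * shift_form a b w)).
  rewrite mulrC big_distrlr (reindex_inj (sqr_inj two0)) /=; apply: eq_bigr => y _.
  rewrite (reindex_inj (inj_comp (addrI (y ^+ 2)) X4_inj)) /=; apply: eq_bigr => w _.
  rewrite {1 2}/chi -chi4D pairing_shift pairingNl /chi -chi4D; congr chi4.
  by rewrite -addrA addKr.
rewrite exchange_big /= mulr_sumr [RHS]big_mkcond /=; apply: eq_bigr => w _.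
rewrite -mulr_sumr (sum_zeta zetaD zeta1) inE.
by case: ifP => _; rewrite ?mulr0 1?mulrC.
Qed.

(* On the kernel, [w -> chi (0, a, b) (epoint (w ^+ 4))] is a character. *)
Lemma sum_shift_ker a b :
  let s := \sum_(w in shift_ker a b) chi (0, a, b) (epoint (w ^+ 4)) in
  s = 0 \/ s = #|shift_ker a b|%:R.
Proof.
set f := fun w => chi (0, a, b) (epoint (w ^+ 4)).
move=> s; have [/forall_inP f1|] := boolP [forall (w | w \in shift_ker a b), f w == 1].
  by right; rewrite -sumr_const; apply: eq_bigr => w /f1/eqP.
rewrite negb_forall_in => /exists_inP[v Kv fv]; left.
have fD w : f (w + v) = f w * f v.
  rewrite /f /chi -chi4D; congr chi4.
  have -> : (w + v) ^+ 4 = (w ^+ 2) ^+ 2 + v ^+ 4 by rewrite X4D (exprM w 2 2).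
  move: Kv; rewrite inE => /eqP Kv.
  by rewrite pairing_shift -/(shift_form a b v) Kv mulr0 lam0 addr0 -exprM.
have : s * (f v - 1) = 0.
  rewrite mulrBr mulr1 /s [X in _ - X](reindex_inj (addIr v)) /= mulr_suml.
  rewrite [X in _ - X](eq_bigl (mem (shift_ker a b))) => [|w]; last first.
    by move: Kv; rewrite !inE shift_formD => /eqP->; rewrite addr0.
  by rewrite -sumrB big1 // => w _; rewrite -/(f w) -/(f (w + v)) fD subrr.
by move/eqP; rewrite mulf_eq0 subr_eq0 (negPf fv) orbF => /eqP.
Qed.

(** With z = w^4, the fourth power of the form is z (b^2 z^3 + (pi a)^4 z + b). The additional
    element is w = 0. *)
Lemma card_shift_ker a b : b != 0 ->
  #|shift_ker a b| = #|cubic_roots (pi a) b|.+1.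
Proof.
move=> b0; set c := fsqrt two0 (fsqrt two0 b).
have cE : b = c ^+ 4 by rewrite fsqrt2X4.
have formE w : shift_form a b w ^+ 4 =
    w ^+ 4 * (b ^+ 2 * (w ^+ 4) ^+ 3 + pi a ^+ 4 * w ^+ 4 + b).
  by rewrite /shift_form -/c !X4D cE; ring.
have K0 : 0 \in shift_ker a b.
  by rewrite inE -(inj_eq X4_inj) /= formE !expr0n /= mul0r.
rewrite (cardsD1 0) K0 add1n; congr _.+1.
rewrite -(card_imset _ X4_inj); apply: eq_card => z; apply/imsetP/idP.
  move=> [w + ->]; rewrite !inE -(inj_eq X4_inj w).
  rewrite -(inj_eq X4_inj (shift_form _ _ _)) /= formE.
  rewrite expr0n /= => /andP[w0]; rewrite mulf_eq0 (negPf w0) //.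
move=> zr; have z0 := cubic_roots_neq0 b0 zr.
exists (fsqrt two0 (fsqrt two0 z)); last by rewrite fsqrt2X4.
rewrite !inE -(inj_eq X4_inj (fsqrt _ _)) -(inj_eq X4_inj (shift_form _ _ _)) /= formE.
by rewrite fsqrt2X4 expr0n z0 mulf_eq0; move: zr; rewrite inE => ->; rewrite orbT.
Qed.

Local Notation h := (m./2).

Lemma m_half : m = h.*2.+1.
Proof. by rewrite -{1}(odd_double_half m) m_odd add1n. Qed.

Lemma wre_norm g k : wsum g * wsum (- g) = k%:R ->
  (`|wre g| ^ 2 + `|wim g| ^ 2 = k)%N.
Proof. by rewrite wsum_norm => /eqP; rewrite eqr_nat => /eqP. Qed.

Lemma wre_norm_q g : wsum g * wsum (- g) = q%:R -> `|wre g|%N = (2 ^ h)%N.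
Proof. by rewrite [in q]m_half => /wre_norm /(proj2 (sum_sqr_pow2 _ _ _)). Qed.

Lemma wre_rootless u a b : rootless (pi a) b -> `|wre (u, a, b)|%N = (2 ^ h)%N.
Proof.
case/andP=> b0 /eqP r0; apply: wre_norm_q.
have := card_shift_ker a b0; rewrite r0 cards0 => /eqP/cards1P[w0 KE].
rewrite wsum_norm_ker (tm_card HT) KE big_set1.
have : 0 \in shift_ker a b by rewrite inE /shift_form !expr0n /= !mulr0 !addr0.
rewrite KE inE => /eqP <-.
rewrite /chi pairing_epoint !expr0n /= (tm_tau0 HT) !mulr0 tr0 lam0 !addr0.
by rewrite chi40 mulr1.
Qed.

(** One root makes |S|^2 equal to 0 or 2q = 2^(2h+2), three roots make it 0 or 4q = 2^(2h+3); a sum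
    of two squares then leaves only 0 and 2^(h+1) for |Re S|. *)
Lemma wre_not_rootless u a b : b != 0 -> ~~ rootless (pi a) b ->
  `|wre (u, a, b)|%N = 0%N \/ `|wre (u, a, b)|%N = (2 ^ h.+1)%N.
Proof.
move=> b0 nr.
have norm0 : wsum (u, a, b) * wsum (- (u, a, b)) = 0 ->
    `|wre (u, a, b)|%N = 0%N \/ `|wre (u, a, b)|%N = (2 ^ h.+1)%N.
  move=> /(@wre_norm _ 0%N)/eqP; rewrite addn_eq0 expn_eq0 andbT => /andP[/eqP-> _].
  by left.
have := wsum_norm_ker u a b; have [->|->] := sum_shift_ker a b.
  by rewrite mulr0 => /norm0.
rewrite card_shift_ker // (tm_card HT) -natrM => /wre_norm.
move: nr; rewrite /rootless b0 /= -cards_eq0.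
case: (card_cubic_roots two0 zetaD zeta_sqr zeta1 (pi a) b0) => [[-> _ _]|[[]-> _ //= _]].
  rewrite {1}m_half -expnSr -[h.*2.+2]/(h.+1.*2) => /(proj1 (sum_sqr_pow2 _ _ _)).
  by case=> ->; [left|right].
rewrite {1}m_half -[4%N]/(2 ^ 2)%N -expnD addn2 -[h.*2.+3]/(h.+1.*2.+1).
by move=> /(proj2 (sum_sqr_pow2 _ _ _)) ->; right.
Qed.

Lemma wre_kerdock u a : pi a != 0 -> `|wre (u, a, 0%R)|%N = (2 ^ h)%N.
Proof.
move=> a0; apply: wre_norm_q; rewrite wsum_norm_ker (tm_card HT).
have fs0 : fsqrt two0 0 = 0 by apply: (sqr_inj two0); rewrite /= fsqrtK expr0n.
have -> : shift_ker a 0 = [set 0].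
  apply/setP => w; rewrite !inE /shift_form !fs0 expr0n /= !mul0r add0r addr0.
  by rewrite mulf_eq0 (negPf a0) expf_eq0.
rewrite big_set1 /chi pairing_epoint !expr0n /= (tm_tau0 HT) !mulr0 tr0 lam0 !addr0.
by rewrite chi40 mulr1.
Qed.

Lemma wsum_two u x : x != 0 -> wsum (u, 2%:R * tau x, 0) = 0.
Proof.
move=> x0; rewrite /wsum (eq_bigr (fun y => chi4 u * zeta (y * x))) => [|y _].
  by rewrite -mulr_sumr (sum_zeta zetaD zeta1) (negPf x0) mulr0.
rewrite /chi pairing_epoint mul0r lam0 addr0 chi4D /zeta -mulrA lam_pi rmorphM !tauK.
by rewrite mulrC [x * y]mulrC mulrC.
Qed.

Lemma wre_two u a : pi a = 0 -> a != 0 -> wre (u, a, 0) = 0.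
Proof.
move=> /(tm_pi_eq0 HT)[x ->] ax; apply/eqP; rewrite -absz_eq0.
have x0 : x != 0 by apply: contra ax => /eqP->; rewrite (tm_tau0 HT) mulr0.
have /(@wre_norm _ 0%N)/eqP :
    wsum (u, 2%:R * tau x, 0) * wsum (- (u, 2%:R * tau x, 0)) = 0%:R.
  by rewrite wsum_two // mul0r.
by rewrite addn_eq0 !expn_eq0 !andbT => /andP[].
Qed.

Lemma wre_const u : wre (u, 0, 0) = q%:Z * re4 u.
Proof.
rewrite /wre (eq_bigr (fun=> re4 u)) => [|x _].
  by rewrite sumr_const (tm_card HT) -mulr_natl natz.
by rewrite pairing_epoint !mul0r tr0 lam0 !addr0.
Qed.

(** * The ten classes and the dual classes *)

Definition gtwo : G := (inZp 2, 0, 0).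

(* Numbered as in [dg_rel]. *)
Definition wclass (g : G) : 'I_10 :=
  let s : int := (2 ^ h)%:Z in
  if g.2 == 0 then
    if wre g == q%:Z then inord 0 else if wre g == s then inord 2 else
    if wre g == 0 then inord 4 else if wre g == - s then inord 7 else inord 9
  else
    if wre g == s *+ 2 then inord 1 else if wre g == s then inord 3 else
    if wre g == 0 then inord 5 else if wre g == - s then inord 6 else inord 8.

Definition wre_tab : seq int :=
  let s : int := (2 ^ h)%:Z in
  [:: q%:Z; s *+ 2; s; s; 0; 0; - s; - s; - (s *+ 2); - q%:Z].

Lemma pow_h_gt0 : 0 < (2 ^ h)%:Z. Proof. by rewrite ltz_nat expn_gt0. Qed.

(** This is where m >= 3 enters: it separates the weights 0 and 2q from q - 2s and q + 2s, where s =
    2^h. *)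
Lemma pow_h_lt_q : (2 ^ h)%:Z *+ 2 < q%:Z.
Proof.
have h0 : (0 < h)%N by rewrite half_gt0; apply: ltn_trans m_ge3.
rewrite [in q]m_half -mulr_natr -[2%:R]/(2%:Z) -PoszM -expnSr ltz_nat ltn_exp2l //.
by rewrite ltnS -addnn -addn1 leq_add2l.
Qed.

Lemma absz_eq_pm (x : int) (n : nat) : `|x|%N = n -> x = n%:Z \/ x = - n%:Z.
Proof. by move=> <-; case: (lerP 0 x) => ?; [left|right]; lia. Qed.

(** The dictionary from a class number to everything needed later. The final branches of [wclass]
    are defaults, reached only at the values -q and -2s; off K, [rootless] can be read from |wre| =
    s. *)
Lemma wclassP g : let k := val (wclass g) in
  [/\ wre g = nth 0 wre_tab k,
      (g.2 == 0) = (k \in [:: 0; 2; 4; 7; 9]%N),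
      (g.2 == 0) && (pi g.1.2 == 0) = (k \in [:: 0; 4; 9]%N) &
      [/\ (g == 0) = (k == 0%N), (g == gtwo) = (k == 9%N) &
      rootless (pi g.1.2) g.2 = (k \in [:: 3; 6]%N)]].
Proof.
case: g => [[u a] b]; rewrite /wclass /=.
have := pow_h_gt0; have := pow_h_lt_q; rewrite /wre_tab.
set s := (2 ^ h)%:Z; set Q := q%:Z => sQ s0.
have pairE (x y : 'Z_4 * R * F) :
    (x == y) = (x.1.1 == y.1.1) && (x.1.2 == y.1.2) && (x.2 == y.2) by [].
rewrite !pairE /=.
have [-> /=|b0 /=] := eqVneq b 0.
  rewrite andbT /rootless eqxx /=.
  have [a0|pa0] := eqVneq (pi a) 0; last first.
    have a0 : (a == 0) = false by apply: contraNF pa0 => /eqP->; rewrite rmorph0.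
    rewrite a0 !andbF.
    have [->|->] := absz_eq_pm (wre_kerdock u pa0); rewrite -/s.
      by rewrite (_ : s == Q = false) ?eqxx ?inordK //; apply/eqP; lia.
    rewrite (_ : - s == Q = false) 1?(_ : - s == s = false)
      1?(_ : - s == 0 = false) ?eqxx ?inordK //; apply/eqP; lia.
  have [aE|an0] := eqVneq a 0; last first.
    by rewrite wre_two // (_ : 0 == Q = false) 1?(_ : 0 == s = false)
      ?eqxx ?inordK ?andbF //; apply/eqP; lia.
  rewrite aE wre_const -/Q !andbT.
  have zero_cl : (0 == Q = false) * (0 == s = false) by split; apply/eqP; lia.
  case: u => [[|[|[|[|]]]]] // lu.
  - have -> : re4 (Ordinal lu) = 1 by [].
    by rewrite mulr1 eqxx inordK.
  - have -> : re4 (Ordinal lu) = 0 by [].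
    by rewrite mulr0 !zero_cl eqxx inordK.
  - have -> : re4 (Ordinal lu) = -1 by [].
    rewrite mulrN1 (_ : - Q == Q = false) 1?(_ : - Q == s = false)
      1?(_ : - Q == 0 = false) 1?(_ : - Q == - s = false) ?inordK //; apply/eqP; lia.
  - have -> : re4 (Ordinal lu) = 0 by [].
    by rewrite mulr0 !zero_cl eqxx inordK.
rewrite !andbF.
have [rl|nrl] := boolP (rootless (pi a) b).
  have [->|->] := absz_eq_pm (wre_rootless u rl); rewrite -/s.
    by rewrite (_ : s == s *+ 2 = false) ?eqxx ?inordK //; apply/eqP; lia.
  by rewrite (_ : - s == s *+ 2 = false) 1?(_ : - s == s = false)
    1?(_ : - s == 0 = false) ?eqxx ?inordK //; apply/eqP; lia.
have s2 : (2 ^ h.+1)%:Z = s *+ 2 by rewrite expnS PoszM mulrC -[RHS]mulr_natr.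
have [] := wre_not_rootless u b0 nrl.
  move=> /absz_eq_pm; rewrite oppr0 => -[] ->;
  by rewrite (_ : 0 == s *+ 2 = false) 1?(_ : 0 == s = false)
    ?eqxx ?inordK //; apply/eqP; lia.
move=> /absz_eq_pm; rewrite s2 => -[] ->; first by rewrite eqxx inordK.
by rewrite (_ : - (s *+ 2) == s *+ 2 = false) 1?(_ : - (s *+ 2) == s = false)
  1?(_ : - (s *+ 2) == 0 = false) 1?(_ : - (s *+ 2) == - s = false)
  ?inordK //; apply/eqP; lia.
Qed.

(** * Teichmuller digits and transforms supported on H *)

Lemma tau_sqrD (x y : F) :
  tau (x ^+ 2 + y ^+ 2) = tau (x ^+ 2) + tau (y ^+ 2) + 2%:R * tau (x * y).
Proof.
rewrite -sqrD (tm_tau_sqrD HT) (tm_tauM HT) !expr2 !(tm_tauM HT); ring.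
Qed.

Lemma two_tauD x y : 2%:R * tau (x + y) = 2%:R * tau x + 2%:R * tau y.
Proof. by rewrite -mulrDr -(tm_two_tau HT (tau x + tau y)) rmorphD !tauK. Qed.

Lemma two_tauN x : - (2%:R * tau x) = 2%:R * tau x.
Proof.
apply: (addrI (2%:R * tau x)); rewrite subrr -two_tauD (addxx two0) (tm_tau0 HT).
by rewrite mulr0.
Qed.

Lemma two_tau_inj : injective (fun x => 2%:R * tau x).
Proof.
move=> x y /= e; apply/eqP; rewrite -(addx_eq0 two0); apply/eqP/(tm_two_tau_eq0 HT).
by rewrite two_tauD e -two_tauD (addxx two0) (tm_tau0 HT) mulr0.
Qed.

Lemma sum_teich_decomp (f : R -> C) :
  \sum_a f a = \sum_x \sum_z f (tau x + 2%:R * tau z).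
Proof.
rewrite pair_big /= (reindex (fun p : F * F => tau p.1 + 2%:R * tau p.2)) //=.
have inj : injective (fun p : F * F => tau p.1 + 2%:R * tau p.2).
  move=> [x z] [x' z'] /= e.
  have xx : x = x'.
    have := congr1 pi e; rewrite !rmorphD !rmorphM /= !tauK.
    by rewrite rmorph_nat two0 !mul0r !addr0.
  by move: e; rewrite xx => /addrI/two_tau_inj->.
have surj a : exists p : F * F, tau p.1 + 2%:R * tau p.2 = a.
  have /(tm_pi_eq0 HT)[z zE] : pi (a - tau (pi a)) = 0 by rewrite rmorphB tauK subrr.
  by exists (pi a, z); rewrite /= -zE addrC subrK.
have [g gK] := fin_all_exists surj.
by exists g => [p|a] _ //; apply: inj; rewrite gK.
Qed.

Lemma sum_chi4 (s : 'Z_4) : \sum_(u : 'Z_4) chi4 (u * s) = if s == 0 then 4%:R else 0.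
Proof.
case: eqP => [->|/eqP s0].
  by rewrite (eq_bigr (fun=> 1)) ?sumr_const ?card_ord // => u _; rewrite mulr0 chi40.
set t := LHS; have : t * (chi4 s - 1) = 0.
  rewrite mulrBr mulr1 /t [X in _ - X](reindex_inj (addIr 1)) /= mulr_suml -sumrB.
  by rewrite big1 // => u _; rewrite mulrDl mul1r chi4D subrr.
by move/eqP; rewrite mulf_eq0 subr_eq0 chi4_eq1 (negPf s0) orbF => /eqP.
Qed.

Local Notation hat := (@hat _ C chi).

(** The annihilator of the elements (u, 2z, 0), that is, the group of characters factoring through
    (u, a, b) -> (pi a, b). *)
Definition inH (y : G) := (y.1.1 == 0) && (pi y.1.2 == 0).

Lemma hat_res (psi : F -> F -> C) y :
  hat (fun g => psi (pi g.1.2) g.2) y =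
  (if y.1.1 == 0 then 4%:R else 0) * ((if pi y.1.2 == 0 then #|F|%:R else 0) *
    \sum_b \sum_x psi x b * (chi4 (tr (tau x * y.1.2)) * zeta (b * y.2))).
Proof.
rewrite -sum_chi4 mulr_suml.
rewrite (_ : hat _ y = \sum_(u : 'Z_4) \sum_(a : R) \sum_(b : F)
   psi (pi a) b * chi (u, a, b) y); last first.
  by rewrite /hat pair_big pair_big /=; apply: eq_bigr => -[[u a] b].
apply: eq_bigr => u _.
rewrite sum_teich_decomp [X in _ = _ * (_ * X)]exchange_big /= !mulr_sumr.
apply: eq_bigr => x _; rewrite exchange_big /= !mulr_sumr; apply: eq_bigr => b _.
rewrite -(sum_zeta zetaD zeta1) mulr_suml mulr_sumr; apply: eq_bigr => z _.
rewrite rmorphD rmorphM /= !tauK rmorph_nat two0 mul0r addr0.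
rewrite /chi /pairing /= mulrDl trD -mulrA lam_pi rmorphM tauK !chi4D /zeta; ring.
Qed.

Lemma hat_res_out psi y : ~~ inH y -> hat (fun g => psi (pi g.1.2) g.2) y = 0.
Proof.
by rewrite hat_res negb_and => /orP[]/negPf->; rewrite ?mul0r ?mulr0.
Qed.

Lemma hat_res_in psi be B : hat (fun g => psi (pi g.1.2) g.2) (0, 2%:R * tau be, B) =
  4%:R * #|F|%:R * \sum_b \sum_x psi x b * zeta (x * be + b * B).
Proof.
rewrite hat_res /= rmorphM rmorph_nat two0 mul0r eqxx mulrA; congr (_ * _).
apply: eq_bigr => b _; apply: eq_bigr => x _.
by rewrite /= [tau x * _]mulrCA lam_pi rmorphM !tauK zetaD.
Qed.

Definition half_lift (A : R) : F := odflt 0 [pick x | A == 2%:R * tau x].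

Lemma half_liftK x : half_lift (2%:R * tau x) = x.
Proof.
by rewrite /half_lift; case: pickP => [z /eqP/two_tau_inj//|/(_ x)]; rewrite eqxx.
Qed.

(** Cell 0 is the trivial character and cell 1 has be = 0, B nonzero. For be nonzero, cells 2 and 3
    record whether the dual cubic has a root, which is all that the transform of [rootless] sees
    there. *)
Definition hclass (y : G) : nat :=
  let be := half_lift y.1.2 in
  if be == 0 then (y.2 != 0 : nat) else if dual_roots be y.2 == set0 then 3 else 2.

Lemma inHP y : inH y -> y = (0, 2%:R * tau (half_lift y.1.2), y.2).
Proof.
case: y => [[s A] B] /andP[/= /eqP-> /eqP/(tm_pi_eq0 HT)[x ->]].
by rewrite half_liftK.
Qed.

Lemma hclass_lt4 y : (hclass y < 4)%N.
Proof. by rewrite /hclass; do 2?case: ifP => // _; case: (y.2 == 0). Qed.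

Lemma hat_one y : hat (fun=> 1) y = if y == 0 then #|{: G}|%:R else 0.
Proof.
rewrite -(sum_chi chi_sym chiDl chi0l chi_nondeg).
by apply: eq_bigr => g _; rewrite mul1r.
Qed.

Lemma hat_one_tab y : inH y ->
  hat (fun=> 1) y = nth 0 [:: #|{: G}|%:R; 0; 0; 0] (hclass y).
Proof.
move=> yH; rewrite hat_one (inHP yH) /hclass /= half_liftK.
rewrite !xpair_eqE eqxx /=.
have -> : (2%:R * tau (half_lift y.1.2) == 0) = (half_lift y.1.2 == 0).
  by apply/eqP/eqP => [/(tm_two_tau_eq0 HT)//|->]; rewrite (tm_tau0 HT) mulr0.
by do 2!case: eqP => //= _; case: ifP.
Qed.

Definition kfun (g : G) : C := (g.2 == 0)%:R.
Definition k0fun (g : G) : C := ((g.2 == 0) && (pi g.1.2 == 0))%:R.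
Definition rfun (g : G) : C := (rootless (pi g.1.2) g.2)%:R.

Lemma hat_kfun_out y : ~~ inH y -> hat kfun y = 0.
Proof. exact: (hat_res_out (fun _ b => (b == 0)%:R)). Qed.
Lemma hat_k0fun_out y : ~~ inH y -> hat k0fun y = 0.
Proof. exact: (hat_res_out (fun x b => ((b == 0) && (x == 0))%:R)). Qed.
Lemma hat_rfun_out y : ~~ inH y -> hat rfun y = 0.
Proof. exact: (hat_res_out (fun x b => (rootless x b)%:R)). Qed.
Lemma hat_one_out y : ~~ inH y -> hat (fun=> 1) y = 0.
Proof. exact: (hat_res_out (fun _ _ => 1)). Qed.

Local Notation c0 := (4%:R * #|F|%:R : C).

Lemma hat_kfun_tab y : inH y ->
  hat kfun y = nth 0 [:: c0 * #|F|%:R; c0 * #|F|%:R; 0; 0] (hclass y).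
Proof.
move=> yH; rewrite (inHP yH) (hat_res_in (fun _ b => (b == 0)%:R)) /hclass /= half_liftK.
rewrite (bigD1 0) //= [X in _ + X]big1 => [|b /negPf b0]; last first.
  by rewrite big1 // => x _; rewrite b0 mul0r.
rewrite addr0 (eq_bigr (fun x => zeta (x * half_lift y.1.2))) => [|x _]; last first.
  by rewrite eqxx mul1r mul0r addr0.
rewrite (sum_zeta zetaD zeta1); case: ifP => _; first by case: (y.2 == 0).
by rewrite mulr0; case: ifP.
Qed.

Lemma hat_k0fun_tab y : inH y -> hat k0fun y = nth 0 [:: c0; c0; c0; c0] (hclass y).
Proof.
move=> yH; rewrite [in LHS](inHP yH) (hat_res_in (fun x b => ((b == 0) && (x == 0))%:R)) /=.
rewrite (bigD1 0) //= [X in _ + X]big1 => [|b /negPf b0]; last first.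
  by rewrite big1 // => x _; rewrite b0 mul0r.
rewrite addr0 (bigD1 0) //= big1 => [|x /negPf x0]; last by rewrite x0 andbF mul0r.
rewrite !eqxx mul1r !mul0r !addr0 (zeta0 zetaD zeta1) mulr1.
by move: (hclass_lt4 y); case: (hclass y) => [|[|[|[|]]]].
Qed.

(** The total of quadratic and dual roots is 3 on cell 2, 0 on cell 3, and 1 on cell 1, where the
    correction for be = 0 leads to the value of cell 2 again. The value [v] at the trivial character
    may stay implicit, as that cell has its own indicator among the transforms. *)
Lemma hat_rfun_tab : exists v : C, forall y, inH y ->
  hat rfun y = c0 / 3%:R * nth 0 [:: v; - (#|F|%:R + 1); - (#|F|%:R + 1); 2%:R * #|F|%:R - 1]
    (hclass y).
Proof.
exists (3%:R * rootless_hat zeta 0 0) => y yH.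
have t0 : 3%:R != 0 :> C by rewrite pnatr_eq0.
rewrite (inHP yH) (hat_res_in (fun x b => (rootless x b)%:R)) /hclass /= half_liftK.
rewrite -/(rootless_hat zeta _ _) -[RHS]mulrA; congr (_ * _).
apply: (mulfI t0); rewrite [RHS]mulrA divff // mul1r.
move: (half_lift y.1.2) (y.2) => be B.
have [->|be0] := eqVneq be 0.
  have [->//|B0] := eqVneq B 0; rewrite /= (rootless_hatE two0 zetaD zeta_sqr zeta1).
  rewrite eqxx (negPf B0) (card_quad_roots0 B0) (card_dual_roots0 two0 zetaD zeta_sqr zeta1).
  by rewrite /=; ring.
have := card_quad_dual_roots two0 zetaD zeta_sqr zeta1 B be0.
case: ifP => _ e /=; rewrite (rootless_hatE two0 zetaD zeta_sqr zeta1) (negPf be0) e.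
  by ring.
by ring.
Qed.

Definition ffun2 (g : G) : C := (wre g)%:~R *+ 2.

Lemma ffun2E g : ffun2 g = \sum_x (chi g (epoint x) + chi g (- epoint x)).
Proof.
rewrite big_split /= [X in _ + X](eq_bigr (fun x => chi (- g) (epoint x))) => [|x _].
  rewrite -/(wsum g) -/(wsum (- g)) !wsumE wreN wimN rmorphN mulrN /ffun2 mulr2n.
  by rewrite addrACA subrr addr0.
by rewrite /chi pairing_sym !pairingNl pairing_sym.
Qed.

Lemma hat_mulf (phi : G -> C) y :
  hat (fun g => phi g * ffun2 g) y =
    \sum_x (hat phi (y + epoint x) + hat phi (y - epoint x)).
Proof.
transitivity (\sum_x (hat (fun g => phi g * chi g (epoint x)) y
                    + hat (fun g => phi g * chi g (- epoint x)) y)); last first.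
  by apply: eq_bigr => x _; rewrite !(hat_mul_chi chi_sym chiDl).
rewrite (eq_bigr (fun x =>
    \sum_g (phi g * (chi g (epoint x) + chi g (- epoint x)) * chi g y))).
  by rewrite exchange_big /=; apply: eq_bigr => g _; rewrite ffun2E mulr_sumr mulr_suml.
by move=> x _; rewrite -big_split /=; apply: eq_bigr => g _; rewrite mulrDr mulrDl.
Qed.

Definition podd (y : G) := odd (val y.1.1).

(* The unique translate of an odd [y] by some [+- epoint x] that lies in [H]. *)
Definition red (y : G) : G :=
  if y.1.1 == 1 then y - epoint (pi y.1.2) else y + epoint (pi y.1.2).

Lemma Z4_cases (s : 'Z_4) : [\/ s = 0, s = 1, s = inZp 2 | s = -1].
Proof.
by case: s => [[|[|[|[|]]]]] // l; [apply: Or41|apply: Or42|apply: Or43|apply: Or44];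
  apply: val_inj.
Qed.

Lemma inH_red y : podd y -> inH (red y).
Proof.
case: y => [[s A] B] /=; rewrite /red /inH /podd /=; case: (Z4_cases s) => -> //= _.
  by rewrite rmorphB tauK subrr eqxx.
by rewrite rmorphD tauK (addxx two0) eqxx.
Qed.

(** Among the translates of y by e_x and -e_x at most one lies in H: the first coordinate fixes the
    sign, the residue of the second fixes x. *)
Lemma hat_mulf_res (phi : G -> C) y : (forall z, ~~ inH z -> hat phi z = 0) ->
  hat (fun g => phi g * ffun2 g) y = if podd y then hat phi (red y) else 0.
Proof.
move=> out; rewrite hat_mulf; case: ifP => [os|/negbT es]; last first.
  rewrite big1 // => x _; rewrite !out ?addr0 // /inH negb_and; apply/orP; left.
    by apply: contra es; rewrite /podd /=; case: (Z4_cases y.1.1) => ->.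
  by apply: contra es; rewrite /podd /=; case: (Z4_cases y.1.1) => ->.
rewrite (bigD1 (pi y.1.2)) //= big1 => [|x xA]; last first.
  rewrite !out ?addr0 // /inH negb_and; apply/orP; right => /=.
    by rewrite rmorphB tauK subr_eq0 eq_sym.
  by rewrite rmorphD tauK (addx_eq0 two0) eq_sym.
rewrite addr0 /red; case: ifP => [/eqP s1|/negbT s1].
  by rewrite [X in X + _]out ?add0r // /inH /= s1.
rewrite [X in _ + X]out ?addr0 // /inH /=; move: os s1; rewrite /podd.
by case: (Z4_cases y.1.1) => ->.
Qed.

(** * Representations of a character by two signed points *)

Definition psum (y : G) := [set p : F * F | epoint p.1 + epoint p.2 == y].
Definition pdiff (y : G) := [set p : F * F | epoint p.1 - epoint p.2 == y].
(** Ordered pairs of signed points with sum y: both signs plus, both minus, or mixed, the mixed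
    signs occurring in two orders. *)
Definition repn (y : G) := (#|psum y| + #|psum (- y)| + #|pdiff y|.*2)%N.

Lemma hat_f2 y : hat (fun g => ffun2 g * ffun2 g) y = #|{: G}|%:R * (repn y)%:R.
Proof.
have hatf z : hat ffun2 z =
    #|{: G}|%:R * \sum_x ((epoint x == - z)%:R + (epoint x == z)%:R).
  rewrite (eq_hat _ (psi := fun g => 1 * ffun2 g)) => [|g]; last by rewrite mul1r.
  rewrite hat_mulf mulr_sumr; apply: eq_bigr => x _; rewrite mulrDr; congr (_ + _).
    by rewrite hat_one -addr_eq0 addrC; case: ifP; rewrite ?mulr1 ?mulr0.
  by rewrite hat_one subr_eq0 eq_sym; case: ifP; rewrite ?mulr1 ?mulr0.
rewrite hat_mulf; under eq_bigr do rewrite !hatf -mulrDr -big_split /=.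
rewrite -mulr_sumr; congr (_ * _).
have cardE (P : F -> F -> bool) : #|[set p : F * F | P p.1 p.2]|%:R
    = \sum_x \sum_x' (P x x')%:R :> C.
  rewrite pair_big /= -sum1dep_card natr_sum big_mkcond /=.
  by apply: eq_bigr => p _; case: (P _ _).
rewrite /repn -addnn !natrD /psum /pdiff.
rewrite (cardE (fun x x' => epoint x + epoint x' == y)).
rewrite (cardE (fun x x' => epoint x + epoint x' == - y)).
rewrite {1}(cardE (fun x x' => epoint x - epoint x' == y)).
rewrite (cardE (fun x x' => epoint x - epoint x' == y)).
rewrite [X in _ = _ + (X + _)]exchange_big /= -!big_split /=; apply: eq_bigr => x _.
rewrite -!big_split /=; apply: eq_bigr => x' _.
have -> : (epoint x' == - (y + epoint x)) = (epoint x + epoint x' == - y).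
  rewrite -[LHS](inj_eq (addrI (epoint x))) opprD.
  by rewrite [in LHS]addrCA subrr addr0.
have -> : (epoint x' == y + epoint x) = (epoint x' - epoint x == y) by rewrite subr_eq.
have -> : (epoint x' == - (y - epoint x)) = (epoint x - epoint x' == y).
  by rewrite opprB eq_sym !subr_eq addrC.
have -> : (epoint x' == y - epoint x) = (epoint x + epoint x' == y).
  by rewrite eq_sym subr_eq eq_sym addrC.

by ring.
Qed.

Lemma fsqrtP (x : F) : exists p, x = p ^+ 2.
Proof. by exists (fsqrt two0 x); rewrite fsqrtK. Qed.

Lemma add_eqF (x y z : F) : (x + y == z) = (x == z + y).
Proof. by rewrite -subr_eq (oppx two0). Qed.

(** With x = p^2 + r^2 and x' = p^2, the digits of the difference are r^2 and p r, and r is nonzero: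
    both r and p are recovered. *)
Lemma teich_diff_uniq (x x' z z' : F) : x != x' ->
  tau x - tau x' = tau z - tau z' -> x = z /\ x' = z'.
Proof.
move=> xx' e; have := congr1 pi e; rewrite !rmorphB !tauK !(oppx two0) => e2.
have [p x'E] := fsqrtP x'; have [w z'E] := fsqrtP z'; have [r rE] := fsqrtP (x + x').
have r0 : r != 0.
  by apply: contra xx' => /eqP r0; rewrite -(addx_eq0 two0) rE r0 expr0n.
have xE : x = p ^+ 2 + r ^+ 2 by apply/eqP; rewrite -x'E -rE addrC -add_eqF.
have zE : z = w ^+ 2 + r ^+ 2 by apply/eqP; rewrite -z'E -rE e2 addrC -add_eqF.
move: e; rewrite xE zE x'E z'E !tau_sqrD ![_ + _ + _ - _]addrAC.
rewrite [tau (p ^+ 2) + _]addrC addrK [tau (w ^+ 2) + _]addrC addrK.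
by move=> /addrI/two_tau_inj/(mulIf r0)->.
Qed.

Lemma teich_sum_sqr (p w : F) :
  tau (p ^+ 2) + tau (w ^+ 2) = tau (p ^+ 2 + w ^+ 2) + 2%:R * tau (p * w).
Proof. by rewrite tau_sqrD -[RHS]addrA -two_tauD (addxx two0) (tm_tau0 HT) mulr0 addr0. Qed.

(** The digits of tau (p^2) + tau (p'^2) are (p + p')^2 and p p': the symmetric functions, which
    determine the pair up to order. *)
Lemma teich_sum_uniq (x x' z z' : F) :
  tau x + tau x' = tau z + tau z' -> (z = x /\ z' = x') \/ (z = x' /\ z' = x).
Proof.
move=> e; have := congr1 pi e; rewrite !rmorphD !tauK => e2.
have [p xE] := fsqrtP x; have [p' x'E] := fsqrtP x'.
have [w zE] := fsqrtP z; have [w' z'E] := fsqrtP z'.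
move: e e2; rewrite xE x'E zE z'E !teich_sum_sqr => + e2; rewrite e2.
move=> /addrI/two_tau_inj ppww.
have ppw : p + p' = w + w' by apply: (sqr_inj two0); rewrite /= !sqrD.
have : (w + p) * (w + p') = 0.
  have -> : (w + p) * (w + p') = w ^+ 2 + w * (p + p') + p * p' by ring.
  rewrite ppw ppww.
  have -> : w ^+ 2 + w * (w + w') + w * w' = 2%:R * (w ^+ 2 + w * w') by ring.
  by rewrite two0 mul0r.
move/eqP; rewrite mulf_eq0 !(addx_eq0 two0) => /orP[]/eqP wE; [left|right].
  by move: ppw; rewrite wE => /addrI->.
by move: ppw; rewrite wE addrC => /addrI->.
Qed.

(** With p, p', w the square roots of x, x', z, distinct x and x' would make (p + w) / (p + p') a
    primitive cube root of unity. Hence y and -y are not both sums of two points when the middle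
    coordinate has nonzero residue. *)
Lemma teich_sum_opp (x x' z z' : F) :
  tau x + tau x' = - (tau z + tau z') -> x = x'.
Proof.
move=> e; have := congr1 pi e; rewrite rmorphN !rmorphD !tauK (oppx two0) => e2.
have [p xE] := fsqrtP x; have [p' x'E] := fsqrtP x'.
have [w zE] := fsqrtP z; have [w' z'E] := fsqrtP z'.
move: e e2; rewrite xE x'E zE z'E !teich_sum_sqr => + e2; rewrite e2.
have ppw : p + p' = w + w' by apply: (sqr_inj two0); rewrite /= !sqrD.
set al := w ^+ 2 + w' ^+ 2; move=> /eqP; rewrite -addr_eq0 addrACA -two_tauD.
rewrite -[tau al + _]mulr2n -[tau al *+ 2]mulr_natl -two_tauD => /eqP/(tm_two_tau_eq0 HT)/eqP.
move=> h0; have [pp'|] := eqVneq (p + p') 0.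
  by apply/eqP; rewrite -(addx_eq0 two0) -sqrD pp' expr0n.
move=> g0; have := no_cube_root1 two0 zetaD zeta_sqr zeta1 ((p + w) / (p + p')).
case/negP; rewrite -(inj_eq (mulfI (expf_neq0 2 g0))) mulr1.
have -> : (p + p') ^+ 2 * (((p + w) / (p + p')) ^+ 2 + (p + w) / (p + p')) =
  (p + w) ^+ 2 + (p + w) * (p + p') by field.
rewrite -(addx_eq0 two0); move: h0; rewrite /al -sqrD -ppw.
have -> : w' = p + p' + w by apply/eqP; rewrite ppw addrAC (addxx two0) add0r.
congr (_ == _).
rewrite [LHS](_ : _ = (p + w) ^+ 2 + (p + w) * (p + p') + (p + p') ^+ 2
    - 2%:R * (p ^+ 2 + p * w)).
  by rewrite two0 mul0r subr0.
ring.
Qed.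

Lemma mem_psum y p : (p \in psum y) =
  [&& inZp 2 == y.1.1, tau p.1 + tau p.2 == y.1.2 & p.1 ^+ 3 + p.2 ^+ 3 == y.2].
Proof. by rewrite inE; case: y => [[s A] B]; rewrite andbA. Qed.

Lemma mem_pdiff y p : (p \in pdiff y) =
  [&& 0 == y.1.1, tau p.1 - tau p.2 == y.1.2 & p.1 ^+ 3 - p.2 ^+ 3 == y.2].
Proof. by rewrite inE; case: y => [[s A] B]; rewrite andbA. Qed.

Lemma repn_odd y : podd y -> repn y = 0%N.
Proof.
move=> oy; rewrite /repn;
have [-> -> ->] : [/\ psum y = set0, psum (- y) = set0 & pdiff y = set0].
  split; apply/setP => p; rewrite ?mem_psum ?mem_pdiff inE; move: oy;
  by rewrite /podd /=; case: (Z4_cases y.1.1) => ->.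
by rewrite !cards0.
Qed.

Lemma psum_set0 y : y.1.1 = 0 -> psum y = set0.
Proof. by move=> y0; apply/setP => p; rewrite mem_psum y0 inE. Qed.

Lemma repn_inH y : inH y -> y != 0 -> repn y = 0%N.
Proof.
case: y => [[s A] B] /andP[/= /eqP-> /eqP A0] yn0.
have N0 : (- ((0, A, B) : G)).1.1 = 0 by rewrite /= oppr0.
rewrite /repn !psum_set0 //.
suff -> : pdiff (0, A, B) = set0 by rewrite !cards0.
apply/setP => p; rewrite !inE; apply: contraNF yn0 => /eqP pE; rewrite -pE.
suff -> : p.1 = p.2 by rewrite subrr.
have /(congr1 pi) : tau p.1 - tau p.2 = A by have := congr1 (fun z : G => z.1.2) pE.
by rewrite rmorphB !tauK A0 => /eqP; rewrite subr_eq0 => /eqP.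
Qed.

Lemma cards_le1 (T : finType) (A : {set T}) :
  {in A &, forall x y, x = y} -> #|A| = 0%N \/ #|A| = 1%N.
Proof.
move=> h; have [->|[x Ax]] := set_0Vmem A; [left|right]; first exact: cards0.
apply/eqP/cards1P; exists x; apply/setP => y; rewrite inE; apply/idP/eqP => [Ay|->//].
exact: h.
Qed.

Lemma card_psum y : pi y.1.2 != 0 -> #|psum y| = 0%N \/ #|psum y| = 2%N.
Proof.
move=> yA; have [->|[p py]] := set_0Vmem (psum y); [left|right]; first exact: cards0.
have pA : tau p.1 + tau p.2 = y.1.2 by move: py; rewrite mem_psum => /and3P[_ /eqP].
suff -> : psum y = [set p; (p.2, p.1)].
  rewrite cards2; case: eqP => // pp; move: yA; rewrite -pA rmorphD !tauK.
  by rewrite (congr1 fst pp) /= (addxx two0) eqxx.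
apply/setP => z; rewrite !inE; apply/idP/orP => [/eqP|[]/eqP->] /=.
- move=> /(congr1 (fun z : G => z.1.2)) /=; rewrite -pA => /teich_sum_uniq.
  case: z => z1 z2; case: (p) => p1 p2 /= [[-> ->]|[-> ->]]; [left|right] => //.
- by move: py; rewrite inE.
- by move: py; rewrite inE addrC.
Qed.

(** Three cases for y = (s, A, B). If s = 0, there is at most one difference, counted twice. If s =
    2 and A has nonzero residue, at most one of y and -y is a sum, and then in two orders. If s = 2
    and A lies in 2R, the only possible sum is some e_p + e_p, shared by y and -y. *)
Lemma repn_even y : ~~ podd y -> ~~ inH y -> repn y = 0%N \/ repn y = 2%N.
Proof.
move=> ey; rewrite /inH negb_and => yH.
have [y0|yn0] := eqVneq y.1.1 0.
  have yA : pi y.1.2 != 0 by move: yH; rewrite y0 eqxx.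
  have N0 : (- y).1.1 = 0 by rewrite /= y0 oppr0.
  rewrite /repn !psum_set0 // cards0 add0n.
  have [|->|->] := @cards_le1 _ (pdiff y); [|by left|by right].
  move=> p z; rewrite !mem_pdiff => /and3P[_ /eqP pA _] /and3P[_ /eqP zA _].
  have p12 : p.1 != p.2.
    by apply: contra yA => /eqP e; rewrite -pA e subrr rmorph0.
  have [] := teich_diff_uniq p12 (etrans pA (esym zA)).
  by case: (p) (z) => p1 p2 [z1 z2] /= -> ->.
have y2 : y.1.1 = inZp 2.
  by move: ey yn0; rewrite /podd; case: (Z4_cases y.1.1) => ->.
have d0 : pdiff y = set0 by apply/setP => p; rewrite mem_pdiff y2 inE.
rewrite /repn d0 cards0 addn0.
have [yA|yA] := eqVneq (pi y.1.2) 0; last first.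
  have yAN : pi (- y).1.2 != 0 by rewrite rmorphN oppr_eq0.
  have [->|] := set_0Vmem (psum y); first by rewrite cards0; exact: card_psum.
  case=> p; rewrite mem_psum => /and3P[_ /eqP pA _].
  have -> : psum (- y) = set0.
    apply/setP => z; rewrite mem_psum inE; apply/negP => /and3P[_ /eqP zA _].
    case/negP: yA; rewrite -pA rmorphD !tauK; apply/eqP.
    have -> : p.1 = p.2; last by rewrite (addxx two0).
    by apply: (@teich_sum_opp _ _ z.1 z.2); rewrite zA pA opprK.
  by rewrite cards0 addn0; exact: card_psum.
have diag (w : G) p : pi w.1.2 = 0 -> p \in psum w -> p.1 = p.2 /\ w.1.2 = 2%:R * tau p.1.
  move=> wA; rewrite mem_psum => /and3P[_ /eqP pA _].
  have /eqP : pi (tau p.1 + tau p.2) = 0 by rewrite pA.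
  rewrite rmorphD !tauK (addx_eq0 two0) => /eqP e; split=> //.
  by rewrite -pA -e -mulr2n mulr_natl.
have psumN : psum (- y) = psum y.
  have half p (w : G) : pi w.1.2 = 0 -> p \in psum w -> p \in psum (- w).
    move=> wA pw; have [e wE] := diag _ _ wA pw; move: pw; rewrite !mem_psum /= wE two_tauN.
    by case/and3P=> /eqP <- /eqP -> /eqP <-; rewrite eqxx -e (addxx two0) oppr0 eqxx !andbT.
  apply/setP => p; apply/idP/idP; last exact: half.
  by rewrite -{2}[y]opprK; apply: half; rewrite rmorphN yA oppr0.
rewrite psumN addnn; have [|->|->] := @cards_le1 _ (psum y); [|by left|by right].
move=> p z py zy; have [ep yp] := diag _ _ yA py; have [ez yz] := diag _ _ yA zy.
have /two_tau_inj e1 : 2%:R * tau p.1 = 2%:R * tau z.1 by rewrite -yp.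
by move: ep ez e1; case: (p) (z) => p1 p2 [z1 z2] /= <- <- ->.
Qed.

(* [0..3]: the cells of [H]; [4], [5]: even characters outside [H], split by
   being a sum of two points [+- epoint x]; [6..9]: odd characters. *)
Definition dclass_nat (y : G) : nat :=
  if podd y then (6 + hclass (red y))%N else
  if inH y then hclass y else if repn y == 0%N then 5 else 4.

Lemma dclass_lt y : (dclass_nat y < 10)%N.
Proof.
rewrite /dclass_nat; case: ifP => _; first by have := hclass_lt4 (red y); lia.
case: ifP => _; first by have := hclass_lt4 y; lia.
by case: ifP.
Qed.

Definition dclass y : 'I_10 := Ordinal (dclass_lt y).

(** Four values on H suffice: they fill cells 0 to 3, and multiplication by [ffun2] moves them to
    cells 6 to 9 through [red]. Entries beyond the end of a list are the default 0. *)
Lemma hat_res_table (phi : G -> C) k0 k1 k2 k3 :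
  (forall y, ~~ inH y -> hat phi y = 0) ->
  (forall y, inH y -> hat phi y = nth 0 [:: k0; k1; k2; k3] (hclass y)) ->
  (hat phi =1 (fun y => nth 0 [:: k0; k1; k2; k3] (dclass y))) /\
  (hat (fun g => phi g * ffun2 g) =1
     (fun y => nth 0 [:: 0; 0; 0; 0; 0; 0; k0; k1; k2; k3] (dclass y))).
Proof.
move=> out tab; split=> y; rewrite ?(hat_mulf_res _ out) /= /dclass_nat.
  case: ifP => oy.
    rewrite out; last first.
      by rewrite /inH negb_and; move: oy; rewrite /podd; case: (Z4_cases y.1.1) => ->.
    by rewrite nth_default // addSn ltnS.
  case: ifP => [|/negbT] yH; first exact: tab.
  by rewrite out //; case: ifP.
case: ifP => oy; first by rewrite tab ?inH_red.
case: ifP => _; last by case: ifP.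
by have := hclass_lt4 y; case: (hclass y) => [|[|[|[|]]]].
Qed.

Lemma hat_delta w y : hat (fun g => (g == w)%:R) y = chi w y.
Proof.
rewrite /hat (bigD1 w) //= eqxx mul1r big1 ?addr0 // => g /negPf->.
by rewrite mul0r.
Qed.

Lemma chi_gtwo y : chi gtwo y = nth 0 [:: 1; 1; 1; 1; 1; 1; -1; -1; -1; -1] (dclass y).
Proof.
have -> : chi gtwo y = if podd y then -1 else 1.
  rewrite /chi /pairing /= !mul0r tr0 lam0 !addr0 /podd -(sqrCi C).
  by case: (Z4_cases y.1.1) => -> //=; rewrite -(expr0 'i).
rewrite /= /dclass_nat; case: ifP => _.
  by have := hclass_lt4 (red y); case: (hclass (red y)) => [|[|[|[|]]]].
case: ifP => _; last by case: ifP.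
by have := hclass_lt4 y; case: (hclass y) => [|[|[|[|]]]].
Qed.

Lemma hclass_eq0 y : inH y -> (hclass y == 0%N) = (y == 0).
Proof.
move=> yH; rewrite [in RHS](inHP yH) !xpair_eqE eqxx /= /hclass.
have -> : (2%:R * tau (half_lift y.1.2) == 0) = (half_lift y.1.2 == 0).
  by apply/eqP/eqP => [/(tm_two_tau_eq0 HT)//|->]; rewrite (tm_tau0 HT) mulr0.
by case: ifP => _; [case: (y.2 == 0)|case: ifP].
Qed.

Lemma repn_table y :
  (repn y)%:R = nth 0 [:: (repn 0)%:R; 0; 0; 0; 2%:R; 0; 0; 0; 0; 0] (dclass y) :> C.
Proof.
rewrite /= /dclass_nat; case: ifP => [|/negbT] oy.
  rewrite repn_odd //.
  by have := hclass_lt4 (red y); case: (hclass (red y)) => [|[|[|[|]]]].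
case: ifP => [|/negbT] yH.
  have [y0|yn0] := eqVneq y 0.
    by have := hclass_eq0 yH; rewrite y0 eqxx => /eqP->.
  have := hclass_eq0 yH; rewrite (negPf yn0) repn_inH //.
  by have := hclass_lt4 y; case: (hclass y) => [|[|[|[|]]]].
by case: (repn_even oy yH) => ->.
Qed.

(** * Indicators as combinations of the ten functions *)

Local Notation DF := (dualfun chi wclass dclass).
Local Notation S := ((2 ^ h)%:R : C).
Local Notation Q := (q%:R : C).

Lemma wclass_tables g :
  [/\ kfun g = nth 0 [:: 1; 0; 1; 0; 1; 0; 0; 1; 0; 1] (wclass g),
      k0fun g = nth 0 [:: 1; 0; 0; 0; 1; 0; 0; 0; 0; 1] (wclass g),
      rfun g = nth 0 [:: 0; 0; 0; 1; 0; 0; 1; 0; 0; 0] (wclass g) &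
      ffun2 g = nth 0 [:: Q *+ 2; S *+ 4; S *+ 2; S *+ 2; 0; 0; - (S *+ 2); - (S *+ 2);
                        - (S *+ 4); - (Q *+ 2)] (wclass g)].
Proof.
have := wclassP g; rewrite /kfun /k0fun /rfun /ffun2 /wre_tab.
case=> -> -> -> [_ _ ->]; split.
- by case10 (wclass g).
- by case10 (wclass g).
- by case10 (wclass g).
case10 (wclass g); rewrite ?rmorphN ?rmorphMn ?mulNrn -?mulrnA //=.
Qed.

Lemma delta_tables g :
  (g == 0)%:R = nth 0 [:: 1] (wclass g) :> C /\
  (g == gtwo)%:R = nth 0 [:: 0; 0; 0; 0; 0; 0; 0; 0; 0; 1] (wclass g) :> C.
Proof.
have [_ _ _ [-> -> _]] := wclassP g.
by case10 (wclass g).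
Qed.

Lemma clsfun_tab (n : nat) (cl : G -> 'I_n) (phi : G -> C) (l : seq C) :
  phi =1 (fun g => nth 0 l (cl g)) -> clsfun cl phi.
Proof. by move=> e g k egk; rewrite !e egk. Qed.

Lemma clsfunM (n : nat) (cl : G -> 'I_n) (phi psi : G -> C) :
  clsfun cl phi -> clsfun cl psi -> clsfun cl (fun g => phi g * psi g).
Proof. by move=> h1 h2 g k e; rewrite (h1 g k) // (h2 g k). Qed.

Lemma kfun_cls : clsfun wclass kfun.
Proof. by apply: clsfun_tab => g; have [e _ _ _] := wclass_tables g; exact: e. Qed.
Lemma k0fun_cls : clsfun wclass k0fun.
Proof. by apply: clsfun_tab => g; have [_ e _ _] := wclass_tables g; exact: e. Qed.
Lemma rfun_cls : clsfun wclass rfun.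
Proof. by apply: clsfun_tab => g; have [_ _ e _] := wclass_tables g; exact: e. Qed.
Lemma ffun2_cls : clsfun wclass ffun2.
Proof. by apply: clsfun_tab => g; have [_ _ _ e] := wclass_tables g; exact: e. Qed.

Lemma one_table :
  (hat (fun=> 1) =1 (fun y => nth 0 [:: #|{: G}|%:R; 0; 0; 0] (dclass y))) /\
  (hat (fun g => 1 * ffun2 g) =1
     (fun y => nth 0 [:: 0; 0; 0; 0; 0; 0; #|{: G}|%:R; 0; 0; 0] (dclass y))).
Proof. exact: (hat_res_table hat_one_out hat_one_tab). Qed.

Lemma dual_one : DF (fun=> 1).
Proof. by split=> //; apply: clsfun_tab; exact: one_table.1. Qed.

Lemma dual_f : DF (fun g => 1 * ffun2 g).
Proof.
split; last by apply: clsfun_tab; exact: one_table.2.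
by apply: clsfunM => //; exact: ffun2_cls.
Qed.

Lemma kfun_table :
  (hat kfun =1 (fun y => nth 0 [:: c0 * #|F|%:R; c0 * #|F|%:R; 0; 0] (dclass y))) /\
  (hat (fun g => kfun g * ffun2 g) =1
     (fun y => nth 0 [:: 0; 0; 0; 0; 0; 0; c0 * #|F|%:R; c0 * #|F|%:R; 0; 0] (dclass y))).
Proof. exact: (hat_res_table hat_kfun_out hat_kfun_tab). Qed.

Lemma dual_k : DF kfun.
Proof. by split; [exact: kfun_cls|apply: clsfun_tab; exact: kfun_table.1]. Qed.

Lemma dual_fk : DF (fun g => kfun g * ffun2 g).
Proof.
split; last by apply: clsfun_tab; exact: kfun_table.2.
by apply: clsfunM; [exact: kfun_cls|exact: ffun2_cls].
Qed.

Lemma k0fun_table : hat k0fun =1 (fun y => nth 0 [:: c0; c0; c0; c0] (dclass y)).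
Proof. exact: (hat_res_table hat_k0fun_out hat_k0fun_tab).1. Qed.

Lemma dual_k0 : DF k0fun.
Proof. by split; [exact: k0fun_cls|apply: clsfun_tab; exact: k0fun_table]. Qed.

Lemma rfun_table : exists v : C,
  (hat rfun =1 (fun y => nth 0 [:: c0 / 3%:R * v; c0 / 3%:R * - (Q + 1);
     c0 / 3%:R * - (Q + 1); c0 / 3%:R * (2%:R * Q - 1)] (dclass y))) /\
  (hat (fun g => rfun g * ffun2 g) =1
     (fun y => nth 0 [:: 0; 0; 0; 0; 0; 0; c0 / 3%:R * v; c0 / 3%:R * - (Q + 1);
     c0 / 3%:R * - (Q + 1); c0 / 3%:R * (2%:R * Q - 1)] (dclass y))).
Proof.
have [v vP] := hat_rfun_tab; exists v; apply: (hat_res_table hat_rfun_out) => y yH.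
rewrite vP // (tm_card HT).
by have := hclass_lt4 y; case: (hclass y) => [|[|[|[|]]]].
Qed.

Lemma dual_r : DF rfun.
Proof.
have [v [vP _]] := rfun_table; split; first exact: rfun_cls.
exact: clsfun_tab vP.
Qed.

Lemma dual_fr : DF (fun g => rfun g * ffun2 g).
Proof.
have [v [_ vP]] := rfun_table; split; last exact: clsfun_tab vP.
by apply: clsfunM; [exact: rfun_cls|exact: ffun2_cls].
Qed.

Lemma dual_f2 : DF (fun g => ffun2 g * ffun2 g).
Proof.
split; first by apply: clsfunM; exact: ffun2_cls.
by move=> y z e; rewrite !hat_f2 (repn_table y) (repn_table z) e.
Qed.

Lemma dual_d0 : DF (fun g => (g == 0)%:R).
Proof.
split; first by apply: clsfun_tab => g; have [e _] := delta_tables g; exact: e.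
by move=> y z _; rewrite !hat_delta !chi0l.
Qed.

Lemma dual_d9 : DF (fun g => (g == gtwo)%:R).
Proof.
split; first by apply: clsfun_tab => g; have [_ e] := delta_tables g; exact: e.
by move=> y z e; rewrite !hat_delta !chi_gtwo e.
Qed.

Lemma S_neq0 : S != 0. Proof. by rewrite pnatr_eq0 -lt0n expn_gt0. Qed.
Lemma Q_neq0 : Q != 0. Proof. by rewrite pnatr_eq0 -lt0n expn_gt0. Qed.

Local Notation dlt k := (fun g => (val (wclass g) == k)%:R : C).

Lemma dual_ind i : DF (ind C wclass i).
Proof.
have S0 := S_neq0.
have Z c phi : DF phi -> DF (fun g => c * phi g) by exact: dualfunZ.
have A phi psi : DF phi -> DF psi -> DF (fun g => phi g + psi g) by exact: dualfunD.
have D0 : DF (dlt 0%N).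
  apply: eq_dualfun dual_d0 => g; have [-> _] := delta_tables g.
  by case10 (wclass g).
have D9 : DF (dlt 9%N).
  apply: eq_dualfun dual_d9 => g; have [_ ->] := delta_tables g.
  by case10 (wclass g).
have D4 : DF (dlt 4%N).
  apply: (eq_dualfun _ (A _ _ dual_k0 (A _ _ (Z (-1) _ D0) (Z (-1) _ D9)))) => g.
  have [_ -> _ _] := wclass_tables g; case10 (wclass g); ring.
(* [a] is the indicator of classes 2 and 7; [b] is 2s on class 2, -2s on class 7 and 0 elsewhere.
   Together they separate the two classes. *)
pose a g := kfun g + -1 * k0fun g.
pose b g := kfun g * ffun2 g + (- Q *+ 2) * (dlt 0%N g + -1 * dlt 9%N g).
have Da : DF a by exact: (A _ _ dual_k (Z _ _ dual_k0)).
have Db : DF b by exact: (A _ _ dual_fk (Z _ _ (A _ _ D0 (Z _ _ D9)))).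
have D2 : DF (dlt 2%N).
  apply: (eq_dualfun _ (A _ _ (Z 2%:R^-1 _ Da) (Z (S *+ 4)^-1 _ Db))) => g; rewrite /a /b.
  by have [-> -> _ ->] := wclass_tables g; case10 (wclass g); field; rewrite S0.
have D7 : DF (dlt 7%N).
  apply: (eq_dualfun _ (A _ _ (Z 2%:R^-1 _ Da) (Z (- (S *+ 4)^-1) _ Db))) => g; rewrite /a /b.
  by have [-> -> _ ->] := wclass_tables g; case10 (wclass g); field; rewrite S0.
have D3 : DF (dlt 3%N).
  apply: (eq_dualfun _ (A _ _ (Z 2%:R^-1 _ dual_r) (Z (S *+ 4)^-1 _ dual_fr))) => g.
  by have [_ _ -> ->] := wclass_tables g; case10 (wclass g); field; rewrite S0.
have D6 : DF (dlt 6%N).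
  apply: (eq_dualfun _ (A _ _ (Z 2%:R^-1 _ dual_r) (Z (- (S *+ 4)^-1) _ dual_fr))) => g.
  by have [_ _ -> ->] := wclass_tables g; case10 (wclass g); field; rewrite S0.
(* Both [c] and [d] live on classes 1 and 8: [c] takes the values 4s and -4s there, [d] takes 16 s^2
   on both. *)
pose c g := 1 * ffun2 g + -1 * (kfun g * ffun2 g + rfun g * ffun2 g).
pose d g := ffun2 g * ffun2 g + (- Q ^+ 2 *+ 4) * (dlt 0%N g + dlt 9%N g)
  + (- S ^+ 2 *+ 4) * (a g + rfun g).
have Dc : DF c by exact: (A _ _ dual_f (Z _ _ (A _ _ dual_fk dual_fr))).
have Dd : DF d.
  exact: (A _ _ (A _ _ dual_f2 (Z _ _ (A _ _ D0 D9))) (Z _ _ (A _ _ Da dual_r))).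
have D1 : DF (dlt 1%N).
  apply: (eq_dualfun _ (A _ _ (Z (S *+ 8)^-1 _ Dc) (Z (S ^+ 2 *+ 32)^-1 _ Dd))) => g.
  rewrite /c /d /a.
  by have [-> -> -> ->] := wclass_tables g; case10 (wclass g); field; rewrite S0.
have D8 : DF (dlt 8%N).
  apply: (eq_dualfun _ (A _ _ (Z (- (S *+ 8)^-1) _ Dc) (Z (S ^+ 2 *+ 32)^-1 _ Dd))) => g.
  rewrite /c /d /a.
  by have [-> -> -> ->] := wclass_tables g; case10 (wclass g); field; rewrite S0.
have D5 : DF (dlt 5%N).
  apply: (eq_dualfun _ (A _ _ dual_one (Z (-1) _ (A _ _ (A _ _ dual_k dual_r) (A _ _ D1 D8))))) => g.
  by have [-> _ -> _] := wclass_tables g; case10 (wclass g); ring.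
suff: DF (dlt (val i)) by [].
by case10 i.
Qed.

Local Notation DI := (dualimg chi wclass).
Local Notation dlt' k := (fun y => (val (dclass y) == k)%:R : C).

Lemma dual_img i : DI (ind C dclass i).
Proof.
have Q0 := Q_neq0.
have N0 : #|{: G}|%:R != 0 :> C by rewrite pnatr_eq0 -lt0n; apply/card_gt0P; exists 0.
have Z c phi : DI phi -> DI (fun g => c * phi g) by exact: dualimgZ.
have A phi psi : DI phi -> DI psi -> DI (fun g => phi g + psi g) by exact: dualimgD.
have [v [r_tab fr_tab]] := rfun_table.
have [one_tab f_tab] := one_table; have [k_tab fk_tab] := kfun_table.
have k0_tab := k0fun_table.
have I_one := dualfun_hat dual_one; have I_f := dualfun_hat dual_f.
have I_k := dualfun_hat dual_k; have I_fk := dualfun_hat dual_fk.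
have I_k0 := dualfun_hat dual_k0; have I_f2 := dualfun_hat dual_f2.
have I_r := dualfun_hat dual_r; have I_fr := dualfun_hat dual_fr.
have I_d0 : DI (fun=> 1).
  by apply: (eq_dualimg _ (dualfun_hat dual_d0)) => y; rewrite hat_delta chi0l.
have I_d9 : DI (chi gtwo).
  by apply: (eq_dualimg _ (dualfun_hat dual_d9)) => y; rewrite hat_delta.
rewrite (tm_card HT) in k_tab fk_tab k0_tab r_tab fr_tab.
have E0 : DI (dlt' 0%N).
  apply: (eq_dualimg _ (Z (#|{: G}|%:R^-1) _ I_one)) => y.
  rewrite one_tab.
  by case10 (dclass y); rewrite ?mulr0 ?mulVf.
have E6 : DI (dlt' 6%N).
  apply: (eq_dualimg _ (Z (#|{: G}|%:R^-1) _ I_f)) => y.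
  rewrite f_tab.
  by case10 (dclass y); rewrite ?mulr0 ?mulVf.
have E1 : DI (dlt' 1%N).
  apply: (eq_dualimg _ (A _ _ (Z ((4%:R * Q * Q)^-1) _ I_k) (Z (-1) _ E0))) => y.
  rewrite k_tab.
  by case10 (dclass y); field; rewrite ?Q0.
have E7 : DI (dlt' 7%N).
  apply: (eq_dualimg _ (A _ _ (Z ((4%:R * Q * Q)^-1) _ I_fk) (Z (-1) _ E6))) => y.
  rewrite fk_tab.
  by case10 (dclass y); field; rewrite ?Q0.
have IH : DI (fun y => (dclass y < 4)%N%:R).
  apply: (eq_dualimg _ (Z ((4%:R * Q)^-1) _ I_k0)) => y.
  rewrite k0_tab.
  by case10 (dclass y); field; rewrite ?Q0.
have IH6 : DI (fun y => (6 <= dclass y)%N%:R).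
  apply: (eq_dualimg _ (A _ _ (Z 2%:R^-1 _ I_d0) (Z (- 2%:R^-1) _ I_d9))) => y.
  by rewrite chi_gtwo; case10 (dclass y); field.
(* The transform of [rfun] agrees on cells 1 and 2, so a multiple of the indicator of H clears both;
   E0 then cancels the contribution of [v] on cell 0. *)
have E3 : DI (dlt' 3%N).
  apply: (eq_dualimg _ (A _ _ (Z ((4%:R * Q * Q)^-1) _ I_r)
    (Z (3%:R * Q)^-1 _ (A _ _ (Z (Q + 1) _ IH) (Z (- (v + Q + 1)) _ E0))))) => y.
  rewrite r_tab.
  by case10 (dclass y); field; rewrite ?Q0.
have E9 : DI (dlt' 9%N).
  apply: (eq_dualimg _ (A _ _ (Z ((4%:R * Q * Q)^-1) _ I_fr)
    (Z (3%:R * Q)^-1 _ (A _ _ (Z (Q + 1) _ IH6) (Z (- (v + Q + 1)) _ E6))))) => y.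
  rewrite fr_tab.
  by case10 (dclass y); field; rewrite ?Q0.
have E2 : DI (dlt' 2%N).
  apply: (eq_dualimg _ (A _ _ IH (Z (-1) _ (A _ _ E0 (A _ _ E1 E3))))) => y.
  by case10 (dclass y); ring.
have E8 : DI (dlt' 8%N).
  apply: (eq_dualimg _ (A _ _ IH6 (Z (-1) _ (A _ _ E6 (A _ _ E7 E9))))) => y.
  by case10 (dclass y); ring.
have E4 : DI (dlt' 4%N).
  apply: (eq_dualimg _ (A _ _ (Z ((#|{: G}|%:R *+ 2)^-1) _ I_f2)
    (Z (- ((repn 0)%:R / 2%:R)) _ E0))) => y.
  rewrite hat_f2 repn_table; move: (repn 0)%:R => r0.
  by case10 (dclass y); field; rewrite N0.
have E5 : DI (dlt' 5%N).
  apply: (eq_dualimg _ (A _ _ I_d0 (Z (-1) _ (A _ _ (A _ _ IH IH6) E4)))) => y.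
  by case10 (dclass y); ring.
suff: DI (dlt' (val i)) by [].
by case10 i.
Qed.

(** Adding e_0 = (1, 0, 0) to representatives in H gives representatives of the odd cells. *)
Lemma dclass_surj i : exists y, dclass y = i.
Proof.
suff [y yE] : exists y, dclass_nat y = i by exists y; exact: val_inj.
have Hin be B : inH (0, 2%:R * tau be, B).
  by rewrite /inH /= rmorphM rmorph_nat two0 mul0r !eqxx.
have Hcl be B : dclass_nat (0, 2%:R * tau be, B) =
    if be == 0 then (B != 0 : nat) else if dual_roots be B == set0 then 3 else 2.
  by rewrite /dclass_nat Hin /podd /hclass /= half_liftK.
have Ocl be B : dclass_nat (1, 2%:R * tau be, B) =
    addn 6 (dclass_nat (0, 2%:R * tau be, B)).
  have p0 : pi (2%:R * tau be) = 0 by rewrite rmorphM rmorph_nat two0 mul0r.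
  have -> : dclass_nat (1, 2%:R * tau be, B) =
    addn 6 (hclass (red (1, 2%:R * tau be, B))) by [].
  have -> : red (1, 2%:R * tau be, B) = (0, 2%:R * tau be, B).
    rewrite /red eqxx /= p0 /epoint (tm_tau0 HT) expr0n /=.
    by congr (_, _, _); rewrite ?subrr ?subr0.
  by rewrite /dclass_nat Hin.
have [B3 B3E] := exists_dual_rootless two0.
have r1 : (1 == 0 :> F) = false by rewrite oner_eq0.
have d2 : dual_roots (1 : F) 0 != set0.
  by apply/set0Pn; exists 0; rewrite inE !expr0n mulr0 !addr0.
case10 i.
- by exists (0, 2%:R * tau 0, 0); rewrite Hcl !eqxx.
- by exists (0, 2%:R * tau 0, 1); rewrite Hcl eqxx r1.
- by exists (0, 2%:R * tau 1, 0); rewrite Hcl r1 (negPf d2).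
- by exists (0, 2%:R * tau 1, B3); rewrite Hcl r1 B3E eqxx.
(* This is e_0 + e_0. *)
- exists (inZp 2, 0, 0); rewrite /dclass_nat /= ifF //.
  have : (0, 0) \in psum (inZp 2, 0, 0).
    by rewrite mem_psum /= (tm_tau0 HT) addr0 expr0n addr0 !eqxx.
  by rewrite /repn (cardD1 (0, 0)) => ->.
(* Two points whose middle coordinates add up to 0 coincide, so their cubes cannot add up to 1. *)
- exists (inZp 2, 0, 1); rewrite /dclass_nat /= ifT //.
  have none s B : B != 0 -> psum (s, 0, B) = set0.
    move=> B0; apply/setP => p; rewrite mem_psum /= inE; apply/negP => /and3P[_ /eqP pA].
    have /eqP : pi (tau p.1 + tau p.2) = 0 by rewrite pA rmorph0.
    rewrite rmorphD !tauK (addx_eq0 two0) => /eqP->.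
    by rewrite (addxx two0) eq_sym (negPf B0).
  have Ny : - ((inZp 2, 0, 1) : G) = (- inZp 2, 0, -1) by congr (_, _, _); rewrite oppr0.
  have d0 : pdiff (inZp 2, 0, 1) = set0.
    by apply/setP => p; rewrite mem_pdiff.
  by rewrite /repn Ny d0 !none ?oppr_eq0 ?oner_eq0 // cards0.
- by exists (1, 2%:R * tau 0, 0); rewrite Ocl Hcl !eqxx.
- by exists (1, 2%:R * tau 0, 1); rewrite Ocl Hcl eqxx r1.
- by exists (1, 2%:R * tau 1, 0); rewrite Ocl Hcl r1 (negPf d2).
- by exists (1, 2%:R * tau 1, B3); rewrite Ocl Hcl r1 B3E eqxx.
Qed.

Lemma wclass_surj i : exists g, wclass g = i.
Proof. exact: (cl_surj dual_img dclass_surj). Qed.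

Lemma wclass_count i j g g' : wclass g = wclass g' ->
  #|[set k | (wclass (g - k) == i) && (wclass k == j)]| =
  #|[set k | (wclass (g' - k) == i) && (wclass k == j)]|.
Proof.
move=> e; apply/eqP; rewrite -(eqr_nat C); apply/eqP.
have cardE u : #|[set k | (wclass (u - k) == i) && (wclass k == j)]|%:R =
    \sum_k ind C wclass i (u - k) * ind C wclass j k.
  rewrite -sum1dep_card natr_sum big_mkcond /=; apply: eq_bigr => k _.
  by rewrite /ind -natrM mulnb; case: (_ && _).
rewrite !cardE.
exact: (convolution_clsfun chi_sym chiDl chi0l chi_nondeg dual_ind dual_img dclass_surj).
Qed.

End Words.

(** * The scheme on codewords *)

Section DelsarteGoethals.
Variables (m : nat) (R : finComUnitRingType) (beta : R).
Hypotheses (m_ge3 : (3 <= m)%N) (m_odd : odd m).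
Hypotheses (HR : galois_ring4 R m) (Hbeta : unit_of_order m beta).
Variables (F : finFieldType) (pi : {rmorphism R -> F}) (tau : F -> R).
Variable pt : F -> Defs.coord m beta.
Local Notation tr := (@z4trace m R beta).
Hypotheses (HT : teichmuller m pi tau tr) (pt_bij : bijective pt).
Hypothesis val_pt : forall x, val (pt x) = tau x.
Local Notation G := ('Z_4 * R * F)%type.
Local Notation W := (word R m beta).
Local Notation pairing := (pairing tau tr).
Local Notation wclass := (wclass m tau tr).
Local Notation q := (2 ^ m)%N.
Local Notation h := (m./2).

Definition dgword (g : G) : W := cw m beta g.1.1 g.1.2 (tau g.2).

Let m_gt0 : (0 < m)%N. Proof. exact: leq_trans m_ge3. Qed.

Lemma dgwordE g z : dgword g (pt z) = pairing g (epoint tau z).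
Proof.
rewrite ffunE val_pt -/(z4trace m beta _) (z4traceD m_gt0 HR Hbeta).
case: g => [[u a] b]; rewrite (pairing_epoint) /= -addrA; congr (_ + (_ + _)).
rewrite -mulrA (lam_pi HT) rmorphM rmorphXn !(tm_tauK HT) //.
Qed.

Lemma dgwordP (x y : W) : (forall z, x (pt z) = y (pt z)) -> x = y.
Proof. by move=> e; apply/ffunP => i; case: pt_bij => f _ fK; rewrite -(fK i) e. Qed.

Lemma word_subE (x y : W) i : (x - y) i = x i - y i.
Proof. by rewrite !ffunE. Qed.

Lemma dgwordB : {morph dgword : g k / g - k}.
Proof.
move=> g k; apply: dgwordP => z; rewrite word_subE !dgwordE.
by rewrite (pairingDl HT) (pairingNl HT).
Qed.

Lemma lee_dgword g : (lee (dgword g))%:Z = q%:Z - wre tau tr g.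
Proof.
rewrite /lee /wre (reindex pt) /=; last exact: onW_bij.
rewrite (big_morph _ PoszD (erefl _)) -(tm_card HT) -sum1_card.
rewrite (big_morph _ PoszD (erefl _)) -sumrB; apply: eq_bigr => z _.
by rewrite dgwordE /re4 opprB addrC subrK.
Qed.

Local Notation wre := (wre tau tr).

Let pow_bounds : (2 ^ h)%:Z *+ 2 < q%:Z /\ 0 < (2 ^ h)%:Z.
Proof. by split; [exact: pow_h_lt_q|exact: pow_h_gt0]. Qed.

Lemma wre_eq_q g : wre g = q%:Z -> g = 0.
Proof.
(* The conclusion involves integers only; [algC] is one choice of field for the characters. *)
have [+ _ _ [g0 _ _]] := wclassP HT m_odd m_ge3 algC g.
have [] := pow_bounds; rewrite /wre_tab; set s := (2 ^ h)%:Z => sq s0 -> e.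
apply/eqP; rewrite g0; move: e.
by case10 (wclass g); lia.
Qed.

(** A zero word has weight 0, that is Re S = q, and the list of values allows this for g = 0 only:
    injectivity is read from the weights. *)
Lemma dgword_inj : injective dgword.
Proof.
move=> g k e; apply/eqP; rewrite -subr_eq0; apply/eqP/wre_eq_q.
have := lee_dgword (g - k); rewrite dgwordB e subrr.
rewrite /lee big1 => [|i _]; last by rewrite ffunE.
by move/eqP; rewrite eq_sym subr_eq0 => /eqP.
Qed.

Lemma mem_teich_tau b : b \in teich m beta -> exists x, b = tau x.
Proof.
move=> bT; case: pt_bij => f _ fK.
by exists (f (Sub b bT)); rewrite -val_pt fK.
Qed.

Lemma tau_teich x : tau x \in teich m beta.
Proof. by rewrite -val_pt; exact: valP. Qed.

Lemma DG_P (v : W) : reflect (exists g, v = dgword g) (v \in DG m beta).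
Proof.
rewrite inE; apply: (iffP existsP)
  => [[u /existsP[a /exists_inP[b bT /eqP->]]]|[[[u a] b] ->]].
  by have [x ->] := mem_teich_tau bT; exists (u, a, x).
exists u; apply/existsP; exists a; apply/exists_inP; exists (tau b) => //.
exact: tau_teich.
Qed.

Lemma dgword_Kerdock g : (dgword g \in Kerdock m beta) = (g.2 == 0).
Proof.
have t0 := tm_tau0 HT; rewrite inE; apply/existsP/eqP => [[u /existsP[a /eqP e]]|g0].
  have /dgword_inj -> // : dgword g = dgword (u, a, 0) by rewrite e /dgword /= t0.
by exists g.1.1; apply/existsP; exists g.1.2; rewrite /dgword g0 t0.
Qed.

(** With s = 2^h, sqrt(2q) is 2s and sqrt(q/2) is s. The bounds 0 < s and 2s < q keep the weights
    apart and the natural subtractions exact. *)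
Lemma dg_relE i g k : dg_rel i (dgword g) (dgword k) = (wclass (g - k) == i).
Proof.
rewrite /dg_rel -dgwordB dgword_Kerdock.
have s1E : (2 ^ (m.+1)./2 = 2 ^ h + 2 ^ h)%N.
  by rewrite -uphalfE uphalf_half m_odd add1n expnS mul2n addnn.
have s2E : (2 ^ (m.-1)./2 = 2 ^ h)%N.
  by rewrite {1}(m_half m_odd) /= doubleK.
rewrite s1E s2E; have := lee_dgword (g - k).
have [-> -> _ _] := wclassP HT m_odd m_ge3 algC (g - k).
have [] := pow_bounds; rewrite /wre_tab.
move: (lee _) (2 ^ h)%N q => w s Q sQ s0.
rewrite -(inj_eq val_inj).
case10 (wclass (g - k)); case10 i; rewrite ?andbF ?andbT => wE;
  lia.
Qed.

Lemma wclassN g : wclass (- g) = wclass g.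
Proof. by rewrite /wclass /= oppr_eq0 (wreN HT). Qed.

Lemma mem_DG g : dgword g \in DG m beta.
Proof. by apply/DG_P; exists g. Qed.

Definition triangles (i j : 'I_10) (g : G) :=
  #|[set k | (wclass (g - k) == i) && (wclass k == j)]|.

Lemma card_triangles i j g g' :
  #|[set z in DG m beta | dg_rel i (dgword g) z && dg_rel j z (dgword g')]|
  = triangles i j (g - g').
Proof.
have inj : injective (fun k => dgword (k + g')) by move=> k l /dgword_inj/addIr.
rewrite /triangles -(card_imset _ inj); apply: eq_card => z; rewrite inE.
apply/andP/imsetP => [[/DG_P[k ->]]|[k]].
  rewrite !dg_relE => kP; exists (k - g'); last by rewrite subrK.
  by rewrite inE opprB addrA subrK.
rewrite inE => kP ->; split; first exact: mem_DG.
by rewrite !dg_relE addrK opprD [- k - g']addrC addrA.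
Qed.

Lemma trianglesC i j g : triangles i j g = triangles j i g.
Proof.
have inj : injective (fun k : G => g - k) by move=> k l /addrI/oppr_inj.
rewrite /triangles -(card_imset _ inj); apply: eq_card => k; rewrite [RHS]inE.
apply/imsetP/idP => [[l + ->]|kP]; first by rewrite inE subKr andbC.
by exists (g - k); rewrite ?subKr // inE subKr andbC.
Qed.

Lemma dg_assoc_scheme : assoc_scheme (DG m beta) (@dg_rel R m beta).
Proof.
split.
- move=> _ _ /DG_P[g ->] /DG_P[k ->]; exists (wclass (g - k)).
  by split=> [|i]; rewrite dg_relE // => /eqP.
- move=> _ _ /DG_P[g ->] /DG_P[k ->]; rewrite dg_relE (inj_eq dgword_inj).
  have [_ _ _ [+ _ _]] := wclassP HT m_odd m_ge3 algC (g - k).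
  by rewrite subr_eq0 => ->.
- move=> i; have [g gi] := wclass_surj HT m_odd m_ge3 algC i.
  exists (dgword g), (dgword 0); split; rewrite ?mem_DG //.
  by rewrite dg_relE subr0 gi.
- move=> i; exists i => _ _ /DG_P[g ->] /DG_P[k ->].
  by rewrite !dg_relE -wclassN opprB.
- move=> i j l; have [d dl] := wclass_surj HT m_odd m_ge3 algC l.
  exists (triangles i j d) => _ _ /DG_P[g ->] /DG_P[k ->].
  rewrite dg_relE card_triangles => /eqP gkl.
  by apply: (wclass_count HT m_odd m_ge3 algC); rewrite dl.
Qed.

Lemma dg_commutative_scheme : commutative_scheme (DG m beta) (@dg_rel R m beta).
Proof.
move=> i j _ _ /DG_P[g ->] /DG_P[k ->].
by rewrite !card_triangles trianglesC.
Qed.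

Lemma dg_translation_scheme : translation_scheme (DG m beta) (@dg_rel R m beta).
Proof.
have w0 : dgword 0 = 0 by rewrite -[0](subrr 0) dgwordB subrr.
split; first by rewrite -w0 mem_DG.
  by move=> _ _ /DG_P[g ->] /DG_P[k ->]; rewrite -dgwordB mem_DG.
by move=> i x y z _ _ _; rewrite /dg_rel opprD addrACA subrr addr0.
Qed.

End DelsarteGoethals.

Theorem theorem3p2 (m : nat) (R : finComUnitRingType) (beta : R) :
  (3 <= m)%N -> odd m ->
  galois_ring4 R m -> unit_of_order m beta ->
  [/\ assoc_scheme (DG m beta) (@dg_rel R m beta),
      commutative_scheme (DG m beta) (@dg_rel R m beta) &
      translation_scheme (DG m beta) (@dg_rel R m beta)].
Proof.
move=> m_ge3 m_odd HR Hbeta; have m_gt0 : (0 < m)%N by exact: leq_trans m_ge3.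
have [F [pi [tau [pt [HT pt_bij val_pt]]]]] := teichmuller_exists m_gt0 HR Hbeta m_odd.
split.
- exact: (dg_assoc_scheme m_ge3 m_odd HR Hbeta HT pt_bij val_pt).
- exact: (dg_commutative_scheme m_ge3 m_odd HR Hbeta HT pt_bij val_pt).
- exact: (dg_translation_scheme m_ge3 HR Hbeta HT pt_bij val_pt).
Qed.
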